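(* The subshift $(\mathbb{X},\sigma)$ constructed in the context does not have dense distal points, however $(K(\mathbb{X}),\sigma_K)$ is a $P$-system. In particular, both $(\mathbb{X},\sigma)$ and $(K(\mathbb{X}),\sigma_K)$ are disjoint from any minimal system.
   Context: Symbolic notation. $\Sigma_2=\{0,1\}^{\mathbb{N}}$ ($\mathbb{N}=\{1,2,\dots\}$) with the product topology, $\sigma(x)_n=x_{n+1}$ is the shift. A subshift is a non-empty closed $\sigma$-invariant subset of $\Sigma_2$. For a finite word $w$ over $\{0,1\}$, $|w|$ is its length and $|w|_1$ the number of occurrences of the symbol $1$; $uv$ denotes concatenation and $u^m$ the $m$-fold concatenation. $L_n(X)$ is the set of words of length $n$ appearing in elements of $X\subset\Sigma_2$. The subshift $X(w,\varepsilon)$. Let $\varepsilon>0$ and let $w$ be a non-empty word with at least one occurrence of $1$. Put $s=|w|$ and choose an integer $t>3s$ with $2s/(s+t)<\varepsilon$ and $2s/t<|w|_1/|w|$. Put $$u_0=w0^tw0^{t+1}w0^t,\quad v_0=w0^{3t+2s+1},\quad u_1=u_0v_0u_0,\quad v_1=u_0v_0,$$ and for $k\ge1$: $u_{k+1}=u_kv_ku_ku_k$, $v_{k+1}=u_kv_kv_ku_k$. Let $z\in\Sigma_2$ be the sequence having every $u_k$ as a prefix, and $X(w,\varepsilon)=\overline{\{\sigma^m z:m\ge0\}}$. The subshift $\mathbb{X}$. Let $\varepsilon_n=9^{-n}$ for $n\ge1$, $w_1=010^{10}$ (the word $0,1$ followed by ten $0$'s) and $M_1=X(w_1,\varepsilon_1)$.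 Inductively, given $M_1,\dots,M_n$, enumerate $L_n(\bigcup_{i=1}^nM_i)=\{u_1,\dots,u_{s_n}\}$, put $$w_{n+1}=u_10^{n9^n}u_20^{n9^n}\cdots u_{s_n}0^{n9^n}$$ and $M_{n+1}=X(w_{n+1},\varepsilon_{n+1})$. Finally $\mathbb{X}=\overline{\bigcup_{n=1}^\infty M_n}$. Dynamical notions. A t.d.s. is a pair $(X,T)$ with $X$ a compact metric space (metric $d$) and $T:X\to X$ continuous surjective. It is minimal if every forward orbit is dense. It is transitive if for all non-empty open $U,V$ the set $\{n\ge0:U\cap T^{-n}V\neq\emptyset\}$ is infinite; it is a $P$-system if it is transitive and its periodic points ($T^nx=x$ for some $n\in\mathbb{N}$) are dense. A pair $(x,y)$ is proximal if there is $n_i\to+\infty$ with $d(T^{n_i}x,T^{n_i}y)\to0$; $x$ is a distal point if it is proximal to no point of its (forward) orbit closure other than itself; the system has dense distal points if the set of distal points is dense. Two t.d.s. $(X,T)$ and $(Y,S)$ are disjoint if the only joining, i.e. non-empty closed $T\times S$-invariant subset $J\subset X\times Y$ projecting onto both $X$ and $Y$, is $X\times Y$. $K(X)$ is the set of non-empty closed subsets of $X$ with the Hausdorff metric and $T_K(A)=T(A)$. *)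

(* Defs.v *)
From HB Require Import structures.
From mathcomp Require Import all_boot all_order all_algebra finmap.
From mathcomp Require Import all_classical all_reals all_analysis.
From mathcomp Require Import zify.

Set Implicit Arguments.
Unset Strict Implicit.
Unset Printing Implicit Defensive.

Import Order.TTheory GRing.Theory Num.Theory.
Import numFieldNormedType.Exports.

Local Open Scope classical_set_scope.
Local Open Scope ring_scope.

Definition forward_orbit {T : Type} (f : T -> T) (x : T) : set T :=
  [set iter n f x | n in [set: nat]].

(* A system is given by a subset [X] of an ambient metric space [T] and a map
   [f : T -> T]; only the restriction of [f] to [X] matters.  Open (closed)
   subsets of [X] are the traces on [X] of open (closed) subsets of [T]. *)
Section Systems.
Context {R : realType} {T : metricType R}.
Implicit Types (X D U V : set T) (f : T -> T) (x y : T).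

Definition tds X f : Prop :=
  [/\ compact X, {within X, continuous f} & f @` X = X].

Definition dense_in X D : Prop := X `<=` closure (X `&` D).

Definition minimal_system X f : Prop :=
  forall x, X x -> dense_in X (forward_orbit f x).

Definition transitive_system X f : Prop :=
  forall U V, open U -> open V -> X `&` U !=set0 -> X `&` V !=set0 ->
  infinite_set [set n : nat | exists x, [/\ X x, U x & V (iter n f x)]].

Definition periodic_points f : set T :=
  [set x | exists2 n : nat, (0 < n)%N & iter n f x = x].

Definition P_system X f : Prop :=
  [/\ tds X f, transitive_system X f & dense_in X (periodic_points f)].

Definition proximal f x y : Prop :=
  exists2 n : nat -> nat, n i @[i --> \oo] --> \oo &
    mdist (iter (n i) f x) (iter (n i) f y) @[i --> \oo] --> (0 : R).

Definition distal_point f x : Prop :=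
  forall y, closure (forward_orbit f x) y -> y <> x -> ~ proximal f x y.

Definition dense_distal_points X f : Prop := dense_in X (distal_point f).

End Systems.

Section Disjointness.
Context {R : realType} {T S : metricType R}.

Definition joining (X : set T) (f : T -> T) (Y : set S) (g : S -> S)
    (J : set (T * S)) : Prop :=
  [/\ J !=set0 /\ J `<=` X `*` Y, closed J,
      forall p, J p -> J (f p.1, g p.2),
      fst @` J = X & snd @` J = Y].

Definition disjoint_systems (X : set T) (f : T -> T) (Y : set S) (g : S -> S)
    : Prop :=
  forall J, joining X f Y g J -> J = X `*` Y.

End Disjointness.

(* The non-empty compact subsets of a metric space; when [X] is compact those
   included in [X] are exactly its non-empty closed subsets, see
   [hyperspaceP]. *)
Record hyper {R : realType} (T : metricType R) : Type := Hyper {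
  hset :> set T;
  hset_neq0 : hset !=set0;
  hset_compact : compact hset }.

Section Hyperspace.
Context {R : realType} {T : metricType R}.
Implicit Types A B C : hyper T.

HB.instance Definition _ := gen_eqMixin (hyper T).
HB.instance Definition _ := gen_choiceMixin (hyper T).

Lemma hyper_inj A B : (A : set T) = B -> A = B.
Proof.
case: A B => [A a1 a2] [B b1 b2] /= AB; subst B.
by congr Hyper; exact: Prop_irrelevance.
Qed.

Definition thickening (A : set T) (e : R) : set T :=
  \bigcup_(a in A) [set x | mdist a x < e].

Definition hausdorff_radii (A B : set T) : set R :=
  [set e | [/\ 0 < e, A `<=` thickening B e & B `<=` thickening A e]].

Definition hausdorff_dist (A B : set T) : R := inf (hausdorff_radii A B).

Lemma hyper_bounded A (b : T) :
  exists M : R, forall a, hset A a -> mdist b a < M.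
Proof.
have cd : continuous (mdist b : T -> R^o).
  move=> x; apply/cvgrPdist_lt => e e0.
  near=> y; have xy : mdist x y < e.
    near: y; have := nbhsx_ballx x _ e0; rewrite ballEmdist.
    by apply: filterS.
  have h1 := metric_triangle b x y; have h2 := metric_triangle b y x.
  rewrite (metric_sym y x) in h2.
  by rewrite ltr_norml; apply/andP; split;
    [rewrite ltrBrDr addrC ltrBlDr; apply: le_lt_trans h1 _; rewrite ltrD2l
    |rewrite ltrBlDl; apply: le_lt_trans h2 _; rewrite ltrD2l].
have /compact_bounded[M [Mr HM]] : compact ((mdist b : T -> R^o) @` A).
  apply: continuous_compact; last exact: hset_compact.
  exact: continuous_subspaceT.
exists (M + 1 + 1) => a Aa.
have /HM : M < M + 1 by rewrite ltrDl.
move=> /(_ (mdist b a)) /= H.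
have /H : exists2 x, hset A x & mdist b x = mdist b a by exists a.
by rewrite ger0_norm ?mdist_ge0 // => /le_lt_trans; apply; rewrite ltrDl.
Unshelve. all: by end_near. Qed.

Lemma hausdorff_radii_neq0 A B : hausdorff_radii A B !=set0.
Proof.
have [a Aa] := hset_neq0 A; have [b Bb] := hset_neq0 B.
have [M HM] := @hyper_bounded A b; have [N HN] := @hyper_bounded B a.
exists (Num.max M N); split.
- have M0 : 0 < M by apply: le_lt_trans (HM _ Aa); exact: mdist_ge0.
  by rewrite lt_max M0.
- by move=> x /HM xM; exists b => //=; rewrite lt_max xM.
- by move=> x /HN xN; exists a => //=; rewrite lt_max xN orbT.
Qed.

Lemma hausdorff_has_inf A B : has_inf (hausdorff_radii A B).
Proof.
split; first exact: hausdorff_radii_neq0.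
by exists 0 => e [/ltW].
Qed.

Lemma thickening_le (A : set T) (d e : R) :
  d <= e -> thickening A d `<=` thickening A e.
Proof. by move=> de x [a Aa /= ax]; exists a => //=; apply: lt_le_trans de. Qed.

Lemma hausdorff_dist_lt A B (e : R) :
  hausdorff_dist A B < e -> hausdorff_radii A B e.
Proof.
move=> /(inf_lt (hausdorff_radii_neq0 A B))[d [d0 AB BA] de].
split; first exact: lt_trans de.
- by move=> x /AB; apply/thickening_le/ltW.
- by move=> x /BA; apply/thickening_le/ltW.
Qed.

Lemma hausdorff_dist_le A B (e : R) :
  hausdorff_radii A B e -> hausdorff_dist A B <= e.
Proof. by move=> ABe; apply: ge_inf => //; case: (hausdorff_has_inf A B). Qed.

Lemma hausdorff_dist_ge0 A B : 0 <= hausdorff_dist A B.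
Proof. by apply: lb_le_inf (hausdorff_radii_neq0 A B) _ => e [/ltW]. Qed.

Lemma hausdorff_distxx A : hausdorff_dist A A = 0.
Proof.
apply/eqP; rewrite eq_le hausdorff_dist_ge0 andbT.
apply/ler_addgt0Pl => e e0; rewrite addr0; apply: hausdorff_dist_le.
by split=> // x Ax; exists x => //=; rewrite mdistxx.
Qed.

Lemma hyper_closed A : closed (A : set T).
Proof.
by apply: compact_closed; [exact: metric_hausdorff|exact: hset_compact].
Qed.

Lemma hausdorff_dist_eq0 A B : hausdorff_dist A B = 0 -> A = B.
Proof.
move=> AB0; apply: hyper_inj.
have H e : 0 < e -> hausdorff_radii A B e.
  by move=> e0; apply: hausdorff_dist_lt; rewrite AB0.
have cl (C D : hyper T) : (forall e, 0 < e -> C `<=` thickening D e) ->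
    (C : set T) `<=` D.
  move=> CD x Cx; apply: hyper_closed => U.
  rewrite -nbhs_ballE => -[e e0 xU].
  have [d Dd /= dx] := CD e e0 x Cx; exists d; split => //; apply: xU.
  by rewrite ballEmdist /= metric_sym.
by apply/seteqP; split; apply: cl => e /H[].
Qed.

Lemma hausdorff_dist_sym A B : hausdorff_dist A B = hausdorff_dist B A.
Proof.
by congr inf; apply/seteqP; split => e [? ? ?]; split.
Qed.

Lemma hausdorff_dist_triangle B A C :
  hausdorff_dist A C <= hausdorff_dist A B + hausdorff_dist B C.
Proof.
apply/ler_addgt0Pr => e e0.
have e20 : 0 < e / 2 by rewrite divr_gt0.
have : hausdorff_radii A B (hausdorff_dist A B + e / 2).
  by apply: hausdorff_dist_lt; rewrite ltrDl.
have : hausdorff_radii B C (hausdorff_dist B C + e / 2).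
  by apply: hausdorff_dist_lt; rewrite ltrDl.
have -> : hausdorff_dist A B + hausdorff_dist B C + e =
    (hausdorff_dist A B + e / 2) + (hausdorff_dist B C + e / 2).
  by rewrite [RHS]addrACA -splitr.
move: (hausdorff_dist B C + _) (hausdorff_dist A B + _) => q p.
move=> [q0 BC CB] [p0 AB BA].
apply: hausdorff_dist_le; split; first exact: addr_gt0.
- move=> x /AB[y /BC[z Cz /= zy] /= yx]; exists z => //=.
  by apply: le_lt_trans (metric_triangle _ y _) _; rewrite addrC ltrD.
- move=> x /CB[y /BA[z Cz /= zy] /= yx]; exists z => //=.
  by apply: le_lt_trans (metric_triangle _ y _) _; rewrite ltrD.
Qed.

HB.instance Definition _ := @isMetric.Build R (hyper T)
  (fun A B => hausdorff_dist A B) hausdorff_distxx hausdorff_dist_eq0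
  hausdorff_dist_sym hausdorff_dist_triangle.

Definition hyperspace (X : set T) : set (hyper T) := [set A | hset A `<=` X].

Lemma hyperspaceP (X B : set T) : compact X ->
  (exists2 A, hyperspace X A & hset A = B) <->
  [/\ B !=set0, closed B & B `<=` X].
Proof.
move=> cX; split=> [[A AX <-]|[B0 cB BX]].
  by split; [exact: hset_neq0|exact: hyper_closed|].
by exists (Hyper B0 (subclosed_compact cB cX BX)).
Qed.

Lemma image_neq0 (f : T -> T) A : f @` A !=set0.
Proof. by have [a Aa] := hset_neq0 A; exists (f a), a. Qed.

Lemma image_compact (f : T -> T) (cf : continuous f) A : compact (f @` A).
Proof.
apply: continuous_compact; last exact: hset_compact.
exact: continuous_subspaceT.
Qed.

Definition hyper_map (f : T -> T) (cf : continuous f) (A : hyper T) : hyper T :=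
  Hyper (image_neq0 f A) (image_compact cf (A:=A)).

End Hyperspace.

(* One-sided binary sequences, indexed from 0, with the library's product
   topology and the compatible metric 2^-(first index where x and y differ). *)
Definition Sigma2 : Type := cantor_space.

HB.instance Definition _ := Pointed.on Sigma2.
HB.instance Definition _ := Uniform.on Sigma2.

Lemma sup_topology_entourage (T : choiceType) (I : Type)
    (Tc : I -> Uniform T) (i : I) (E : set (T * T)) :
  @entourage (Uniform.Pack (Tc i)) E -> @entourage (sup_topology Tc) E.
Proof.
move=> eE; have iE : `[< @entourage (Uniform.Pack (Tc (i, E).1)) (i, E).2 >].
  exact/asboolP.
exists E => //; pose p := exist (fun p : {classic I} * set (T * T) => is_true `[< @entourage (Uniform.Pack (Tc p.1)) p.2 >]) (i, E) iE.
exists [fset p]%fset; first by move=> ? _; rewrite inE.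
by rewrite set_fset1 bigcap_set1.
Qed.

Lemma entourage_coordinate (i : nat) :
  entourage [set p : Sigma2 * Sigma2 | p.1 i = p.2 i].
Proof.
apply: (@sup_topology_entourage (prod_topology (fun _ : nat => bool)) nat
  (fun i => Uniform.class (initial_topology (@proj _ (fun _ : nat => bool) i)))
  i).
exists [set p : bool * bool | p.1 = p.2] => //.
by rewrite uniform_discrete => _ [b _ <-].
Qed.

Lemma entourage_prefix (n : nat) : entourage
  [set p : Sigma2 * Sigma2 | forall i, (i <= n)%N -> p.1 i = p.2 i].
Proof.
have : \forall p \near @entourage Sigma2,
    forall i : 'I_n.+1, (p.1 : Sigma2) i = (p.2 : Sigma2) i.
  by apply: filter_forall => i; exact: entourage_coordinate.
by apply: filterS => -[x y] /= xy i; rewrite -ltnS => ii; exact: (xy (Ordinal ii)).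
Qed.

Lemma Sigma2_entourage (A : set (Sigma2 * Sigma2)) : entourage A -> exists n,
  [set p : Sigma2 * Sigma2 | forall i, (i <= n)%N -> p.1 i = p.2 i] `<=` A.
Proof.
move=> [B [/= F _ <-] BA].
exists (\max_(q : F) ((val (val q)).1 : nat)).
move=> [x y] /= xy; apply: BA => p pF.
have xyi : x (val p).1 = y (val p).1 by apply: xy; exact: (leq_bigmax (FSetSub pF)).
case: p pF xyi => -[i E] iE pF /= xyi; have /asboolP[C eC] := iE; apply => /=.
have -> : (unstable.map_pair (proj i) (x, y)) = (x i, y i) by [].
rewrite -xyi; exact: entourage_refl.
Qed.

Section Sigma2_metric.
Context {R : realType}.
Implicit Types x y : Sigma2.

Definition Sigma2_dist x y : R :=
  if pselect (exists n, x n != y n) is left xy then 2 ^- ex_minn xy else 0.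

Lemma Sigma2_dist_ltP x y n :
  Sigma2_dist x y < 2 ^- n <-> forall i, (i <= n)%N -> x i = y i.
Proof.
rewrite /Sigma2_dist; case: pselect => [xy|xy]; last first.
  split=> _; last by rewrite invr_gt0 exprn_gt0.
  by move=> i _; apply/eqP; apply: contra_notT xy => ?; exists i.
case: ex_minnP => m xym mmin.
rewrite ltf_pV2 ?posrE ?exprn_gt0 // ltr_eXn2l ?ltr1n //; split=> [nm i ni|H].
  by apply/eqP; apply: contraTT nm => /mmin mi; rewrite -leqNgt (leq_trans mi).
by rewrite ltnNge; apply: contraNN xym => /H ->.
Qed.


Lemma Sigma2_dist_ge0 x y : 0 <= Sigma2_dist x y.
Proof.
by rewrite /Sigma2_dist; case: pselect => // xy; rewrite invr_ge0 exprn_ge0.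
Qed.

Lemma Sigma2_dist_eq0 x y : Sigma2_dist x y = 0 -> x = y.
Proof.
move=> xy0; apply/funext => n.
have : Sigma2_dist x y < 2 ^- n by rewrite xy0 invr_gt0 exprn_gt0.
by move=> /Sigma2_dist_ltP; apply.
Qed.

Lemma Sigma2_distxx x : Sigma2_dist x x = 0.
Proof.
by rewrite /Sigma2_dist; case: pselect => // xx; case: ex_minnP => n; rewrite eqxx.
Qed.

Lemma Sigma2_dist_ball (x y : Sigma2) (e : R) : 0 < e ->
  (forall n, e <= 2 ^- n -> x n = y n) -> Sigma2_dist x y < e.
Proof.
move=> e0 H; rewrite /Sigma2_dist; case: pselect => // xy.
case: ex_minnP => m xym _; rewrite ltNge; apply: contraNN xym => em.
by rewrite H.
Qed.

Lemma Sigma2_ball_dist (x y : Sigma2) (e : R) n :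
  Sigma2_dist x y < e -> e <= 2 ^- n -> x n = y n.
Proof.
move=> xye en; have : Sigma2_dist x y < 2 ^- n by apply: lt_le_trans en.
by move=> /Sigma2_dist_ltP; apply.
Qed.

Lemma Sigma2_dist_sym x y : Sigma2_dist x y = Sigma2_dist y x.
Proof.
have le a b : Sigma2_dist a b <= Sigma2_dist b a.
  apply/ler_addgt0Pl => e e0; apply/ltW; apply: Sigma2_dist_ball => [|n en].
    by rewrite ltr_wpDr // Sigma2_dist_ge0.
  by apply/esym/(Sigma2_ball_dist _ en); rewrite ltrDr.
by apply/eqP; rewrite eq_le !le.
Qed.

Lemma Sigma2_dist_triangle y x z :
  Sigma2_dist x z <= Sigma2_dist x y + Sigma2_dist y z.
Proof.
apply/ler_addgt0Pl => e e0; apply/ltW.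
have xy0 := Sigma2_dist_ge0 x y; have yz0 := Sigma2_dist_ge0 y z.
apply: Sigma2_dist_ball => [|n en].
  by rewrite ltr_wpDr // addr_ge0.
transitivity (y n); apply: (Sigma2_ball_dist _ en).
  by rewrite ltr_pwDl // lerDl.
by rewrite ltr_pwDl // lerDr.
Qed.

Let dist_ball x (e : R) : set Sigma2 := [set y | Sigma2_dist x y < e].

Lemma Sigma2_entourageE : @entourage Sigma2 = entourage_ dist_ball.
Proof.
apply/seteqP; split => A.
- move=> /Sigma2_entourage[n nA]; exists (2 ^- n).
    by rewrite /= invr_gt0 exprn_gt0.
  by move=> [x y] /= /Sigma2_dist_ltP xy; exact: nA.
- move=> [e e0 eA].
  have [n ne] : exists n, 2 ^- n < e :> R.
    have [n _ /(_ n (leqnn n)) ne] := near_infty_natSinv_expn_lt (PosNum e0).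
    by exists n; rewrite -div1r.
  apply: filterS (entourage_prefix n) => -[x y] /= xy; apply: eA => /=.
  by apply: lt_trans ne; apply/Sigma2_dist_ltP.
Qed.

Let dist_ball_center x (e : R) : 0 < e -> dist_ball x e x.
Proof. by move=> e0; rewrite /dist_ball /= Sigma2_distxx. Qed.

Let dist_ball_sym x y (e : R) : dist_ball x e y -> dist_ball y e x.
Proof. by rewrite /dist_ball /= Sigma2_dist_sym. Qed.

Let dist_ball_triangle x y z (e1 e2 : R) :
  dist_ball x e1 y -> dist_ball y e2 z -> dist_ball x (e1 + e2) z.
Proof.
move=> xy yz; apply: le_lt_trans (Sigma2_dist_triangle y x z) _.
exact: ltrD.
Qed.

HB.instance Definition _ := @Uniform_isPseudoMetric.Build R Sigma2
  dist_ball dist_ball_center dist_ball_sym dist_ball_triangle Sigma2_entourageE.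

HB.instance Definition _ := @PseudoMetric_isMetric.Build R Sigma2
  (@Sigma2_dist) Sigma2_dist_ge0 Sigma2_dist_eq0 (fun _ _ => erefl).

End Sigma2_metric.

Definition sigma (x : Sigma2) : Sigma2 := fun n => x n.+1.

Lemma sigma_continuous : continuous sigma.
Proof.
move=> x; apply/cvg_entourageP => A /Sigma2_entourage[n nA].
have : \forall y \near x, forall i, (i <= n.+1)%N -> x i = y i.
  by apply: filterS (nbhs_entourage x (entourage_prefix n.+1)) => y /xsectionP.
by apply: filterS => y xy; apply: nA => i /= ni; exact: xy.
Qed.

Definition subshift (X : set Sigma2) : Prop :=
  [/\ X !=set0, closed X & sigma @` X `<=` X].

Definition word : Type := seq bool.

Definition zeros (n : nat) : word := nseq n false.

Definition ones (w : word) : nat := count_mem true w.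

Definition language (n : nat) (X : set Sigma2) : set word :=
  [set u | exists2 x, X x & exists i, u = mkseq (fun j => x (i + j)%N) n].

Section BasicSubshift.
Variables (w : word) (t : nat).

(* The pair (u_k, v_k); the step from 0 to 1 is special. *)
Fixpoint uv (k : nat) : word * word :=
  match k with
  | 0 => (w ++ zeros t ++ w ++ zeros t.+1 ++ w ++ zeros t,
          w ++ zeros (3 * t + 2 * size w + 1)%N)
  | k'.+1 =>
      let: (u, v) := uv k' in
      if k' == 0%N then (u ++ v ++ u, u ++ v)
      else (u ++ v ++ u ++ u, u ++ v ++ v ++ u)
  end.

Definition limit_point : Sigma2 := fun n => nth false (uv n).1 n.

Lemma size_uv k : (k < size (uv k).1)%N /\ (0 < size (uv k).2)%N.
Proof.
elim: k => [|k] /=; first by rewrite /zeros !(size_cat, size_nseq) /= !(size_cat, size_nseq); split; lia.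
by case: (uv k) => u v /= [uk v0]; case: ifP => _ /=; rewrite !size_cat; split; lia.
Qed.

Lemma uv_prefix k m : exists s, (uv (k + m)%N).1 = (uv k).1 ++ s.
Proof.
elim: m => [|m [s IH]]; first by exists [::]; rewrite addn0 cats0.
rewrite addnS /=; case: (uv (k + m)%N) IH => u v /= ->.
by case: ifP => _ /=; rewrite -catA; eexists.
Qed.

Lemma limit_pointP k i :
  (i < size (uv k).1)%N -> limit_point i = nth false (uv k).1 i.
Proof.
move=> ik; rewrite /limit_point; have [ii _] := size_uv i.
have [ki|/ltnW ki] := leqP k i.
  have [s] := uv_prefix k (i - k); rewrite subnKC // => ->.
  by rewrite nth_cat ik.
have [s] := uv_prefix i (k - i); rewrite subnKC // => ->.
by rewrite nth_cat ii.
Qed.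

(* X(w, eps); eps only enters through the constraint on [t], see [gap]. *)
Definition basic_subshift : set Sigma2 :=
  closure (forward_orbit sigma limit_point).

Definition gap (R : realType) (eps : R) : Prop :=
  [/\ (3 * size w < t)%N,
      (2 * size w)%N%:R / (size w + t)%N%:R < eps &
      (2 * size w)%N%:R / t%:R < (ones w)%:R / (size w)%:R :> R].

End BasicSubshift.

(* The words w_n, the integers t_n chosen in the construction of
   M_n = X(w_n, 9^-n), and the chosen enumerations of the languages; all the
   sequences are indexed from 1, their value at 0 is irrelevant. *)
Section Construction.
Variables (w : nat -> word) (t : nat -> nat) (e : nat -> seq word).

Definition MM (n : nat) : set Sigma2 := basic_subshift (w n) (t n).

Record construction (R : realType) : Prop := {
  w_1 : w 1%N = [:: false; true] ++ zeros 10;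
  w_succ : forall n, (1 <= n)%N ->
    w n.+1 = flatten [seq u ++ zeros (n * 9 ^ n)%N | u <- e n];
  e_uniq : forall n, (1 <= n)%N -> uniq (e n);
  e_enum : forall n, (1 <= n)%N -> forall u,
    u \in e n <-> language n (\bigcup_(i in [set i | (1 <= i <= n)%N]) MM i) u;
  t_gap : forall n, (1 <= n)%N -> gap (w n) (t n) (9 ^- n : R) }.

Definition XX : set Sigma2 :=
  closure (\bigcup_(n in [set n | (1 <= n)%N]) MM n).

End Construction.

(* Main.v *)
(* A point x of XX that begins with 1 and is distal leads to a contradiction. If
   x has arbitrarily long runs of 0, it is proximal to the fixed point 0^oo.
   Otherwise the blocks 0^(n 9^n) separating the words enumerated in w_(n+1)
   force x to lie in some M_n. In M_n all the words u_k and v_k have lengths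
   divisible by L = |u_0|, and in units of L the differences of two occurrences
   of u_k contain arbitrarily long intervals, because the underlying sequence of
   letters is not balanced, whereas the occurrences of u_k in x have bounded
   gaps; so one can build word by word a point y <> x of M_n that agrees with x
   on longer and longer windows.

   On the other hand w_n occurs in the generating point of M_n at every
   multiple of L, so that every word of the language of XX starts all the
   points of some set invariant under a power of sigma; and w_n occurs at the
   times h and h + 1 after an occurrence, which iterated along n makes the
   sets of return times contain arbitrarily long intervals, with the same
   interval for finitely many pairs of words. Both properties pass to the
   hyperspace. Disjointness follows: given a joining with a minimal system
   (Y, g) and open sets U and W, choose a point whose orbit visits U along
   progressions of period p that are long and start in all the residue
   classes modulo p, whereas the decomposition of Y into minimal sets for g^p
   makes every orbit of Y meet W along such progressions in one of the
   residue classes. *)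

Require Import Defs.
From mathcomp Require Import all_boot all_order all_algebra.
From mathcomp Require Import all_classical all_reals all_analysis.
From mathcomp Require Import zify.

Set Implicit Arguments.
Unset Printing Implicit Defensive.

Import Order.TTheory GRing.Theory Num.Theory.
Import numFieldNormedType.Exports.

Local Open Scope classical_set_scope.
Local Open Scope nat_scope.

(** * The sequence of letters and the generating point *)

(* The fixed point of the substitution true -> 1011, false -> 1001; the
   fuel [n] exceeds the number of divisions by 4. *)
Fixpoint letter_rec (fuel n : nat) : bool :=
  if fuel is f.+1 then
    if n %% 4 == 2 then letter_rec f (n %/ 4) else n %% 4 != 1
  else true.

Definition letter (n : nat) : bool := letter_rec n n.

Lemma letter_recE f n : n <= f -> letter_rec f n = letter n.
Proof.
suff H g : n <= f -> n <= g -> letter_rec f n = letter_rec g n by move=> /H;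
  apply.
elim: f n g => [|f IH] n g /=.
  by rewrite leqn0 => /eqP ->; case: g.
case: g => [|g] nf ng /=; first by move: ng; rewrite leqn0 => /eqP ->.
by case: eqP => // n2; apply: IH; lia.
Qed.

Lemma letter4 n : letter (4 * n) = true.
Proof.
case: n => // n; have -> : 4 * n.+1 = (4 * n + 3).+1 by lia.
by rewrite /letter /= -addnS mulnC modnMDl.
Qed.

Lemma letter4_1 n : letter (4 * n + 1) = false.
Proof. by rewrite addn1 /letter /= -addn1 mulnC modnMDl. Qed.

Lemma letter4_2 n : letter (4 * n + 2) = letter n.
Proof.
rewrite -[RHS](@letter_recE (4 * n).+1); last by lia.
by rewrite addn2 /letter [LHS]/= -addn2 mulnC modnMDl /= divnMDl // addn0.
Qed.

Lemma letter4_3 n : letter (4 * n + 3) = true.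
Proof. by rewrite addn3 /letter /= -addn3 mulnC modnMDl. Qed.

Fixpoint letter_count (n : nat) : nat :=
  if n is m.+1 then letter_count m + letter m else 0.

Lemma letter_count4 n : letter_count (4 * n) = 2 * n + letter_count n.
Proof.
elim: n => // n IH.
have -> : 4 * n.+1 = (4 * n).+4 by lia.
rewrite /= IH -[(4 * n).+3]addn3 -[(4 * n).+2]addn2 -[(4 * n).+1]addn1.
by rewrite letter4 letter4_1 letter4_2 letter4_3 /=; lia.
Qed.

Lemma letter_count4_1 n :
  letter_count (4 * n + 1) = 2 * n + letter_count n + 1.
Proof. by rewrite addn1 /= letter_count4 letter4. Qed.

Lemma letter_count4_2 n :
  letter_count (4 * n + 2) = 2 * n + letter_count n + 1.
Proof.
by rewrite addn2 /= letter_count4 letter4 -[(4 * n).+1]addn1 letter4_1 addn0.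
Qed.

Lemma letter_count4_3 n :
  letter_count (4 * n + 3) = 2 * n + letter_count n + 1 + letter n.
Proof.
rewrite addn3 /= letter_count4 letter4 -[(4 * n).+2]addn2 letter4_2.
by rewrite -[(4 * n).+1]addn1 letter4_1 addn0.
Qed.

(* The letters are not balanced: the factors [0, m) and [M - m, M) have counts
   differing by [i], where M = 16^i and m = 7 (16^i - 1) / 15. *)
Lemma letter_count_unbalanced i : exists m M, [/\ m < M, letter (M - m).-1 &
  letter_count M = letter_count (M - m) + letter_count m + i].
Proof.
elim: i => [|i [m [M [mM lm IH]]]]; first by exists 0, 1.
exists (16 * m + 7), (16 * M).
(* The letter at [a] is 1, so [letter_count (M - m)] is [letter_count a + 1]; [a] enters since 16 M
   - (16 m + 7) = 4 (4 a + 2) + 1. *)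
have [a aE] : exists a, M - m = a.+1 by exists (M - m).-1; lia.
have ME : M = a.+1 + m by lia.
rewrite aE /= in lm IH.
have -> : 16 * M - (16 * m + 7) = 4 * (4 * a + 2) + 1 by lia.
split; first by lia.
  by rewrite addn1 /= letter4.
have -> : 16 * M = 4 * (4 * M) by lia.
have -> : 16 * m + 7 = 4 * (4 * m + 1) + 3 by lia.
rewrite letter_count4_1 letter_count4_2 letter_count4_3 letter_count4_1.
by rewrite !letter_count4 letter4_1 IH lm; lia.
Qed.

(* Discrete intermediate values: the count in a window changes by at most one
   when the window moves by one letter. *)
Lemma letter_count_ivt m n v :
  letter_count m <= v -> v + letter_count n <= letter_count (n + m) ->
  exists n', v + letter_count n' = letter_count (n' + m).
Proof.
move=> mv; elim: n => [|n IH] H; first by exists 0; rewrite /= add0n in H *;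
  lia.
have [/IH//|lt] := leqP (v + letter_count n) (letter_count (n + m)).
by exists n.+1; move: H; rewrite addSn /=; do 2 case: letter => /=; lia.
Qed.

(* [block_pos k n] is the position, in blocks of length |u_0|, of the n-th
   block u_(k+1) or v_(k+1); these have [vlen k + 1] and [vlen k] blocks. *)
Fixpoint vlen (k : nat) : nat := if k is k'.+1 then 4 * vlen k' + 2 else 2.

Definition block_pos (k n : nat) : nat := n * vlen k + letter_count n.

Lemma vlen_ge k : 2 <= vlen k.
Proof. by case: k => //= k; lia. Qed.

Lemma block_posS k n : block_pos k n.+1 = block_pos k n + vlen k + letter n.
Proof. by rewrite /block_pos /= mulSn; lia. Qed.

Lemma block_pos4 k n : block_pos k (4 * n) = block_pos k.+1 n.
Proof. by rewrite /block_pos letter_count4 /=; lia. Qed.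

Lemma block_pos_between k q :
  exists n, block_pos k n <= q < block_pos k n.+1.
Proof.
elim: q => [|q [n /andP[n1 n2]]].
  by exists 0; rewrite block_posS /block_pos /=; have := vlen_ge k; lia.
have [lt|ge] := ltnP q.+1 (block_pos k n.+1); first by exists n; lia.
by exists n.+1; rewrite (block_posS _ n.+1); have := vlen_ge k; lia.
Qed.

Lemma block_pos_next k q : exists n, q <= block_pos k n <= q + vlen k + 1.
Proof.
have [n /andP[n1 n2]] := block_pos_between k q.
by exists n.+1; move: n2; rewrite block_posS; case: letter => /=; lia.
Qed.

(** Among windows with a fixed number of letters, the length in blocks depends only on the letter
    count, which runs through a long interval by unbalance. An imbalance of [N + B] leaves room to
    start the interval [B] above the count of the initial window. *)
Lemma block_pos_thick k N B : exists2 m, B <= m & forall i, i <= N ->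
  exists n n', block_pos k n' = block_pos k n + m + i.
Proof.
have [m [M [mM _ E]]] := letter_count_unbalanced (N + B).
exists (m * vlen k + letter_count m + B).
  by lia.
move=> i iN; set v := letter_count m + B + i.
have [n En] : exists n', v + letter_count n' = letter_count (n' + m).
  apply: (@letter_count_ivt m (M - m) v); first by rewrite /v; lia.
  by rewrite (subnK (ltnW mM)) E /v; lia.
by exists n, (n + m); rewrite /block_pos -En mulnDl /v; lia.
Qed.

(** * Occurrences of words and the block decomposition of the generating point *)

Definition occurs (x : nat -> bool) (q : nat) (u : word) : Prop :=
  forall i, i < size u -> x (q + i) = nth false u i.

Lemma occurs_cat x q u v :
  occurs x q (u ++ v) <-> occurs x q u /\ occurs x (q + size u) v.
Proof.
split=> [H|[Hu Hv] i].
  split=> i iu.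
    by have := H i; rewrite size_cat nth_cat iu; apply; lia.
  have := H (size u + i); rewrite size_cat nth_cat ltn_add2l => /(_ iu).
  by rewrite addnA => ->; rewrite ltnNge leq_addr /= addKn.
rewrite size_cat nth_cat => iuv; case: ltnP => iu; first exact: Hu.
by rewrite -Hv ?ltn_subLR // -addnA subnKC.
Qed.

Lemma occurs_mkseq x q (y : nat -> bool) p n :
  occurs x q (mkseq (fun j => y (p + j)) n) <->
  forall i, i < n -> x (q + i) = y (p + i).
Proof.
rewrite /occurs size_mkseq.
by split=> H i ni; have := H i ni; rewrite nth_mkseq.
Qed.

Lemma occurs_zeros x q n :
  occurs x q (zeros n) <-> forall i, i < n -> x (q + i) = false.
Proof.
rewrite /occurs size_nseq.
by split=> H i ni; have := H i ni; rewrite nth_nseq ni.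
Qed.

Lemma occurs_flatten x q ss s1 s s2 : occurs x q (flatten ss) ->
  ss = s1 ++ s :: s2 -> occurs x (q + size (flatten s1)) s.
Proof. by move=> H E; move: H;
  rewrite E flatten_cat /= => /occurs_cat[_ /occurs_cat[]]. Qed.

Section Blocks.
Variables (w : word) (t : nat).
Let z := Defs.limit_point w t.
Let u k := (uv w t k).1.
Let v k := (uv w t k).2.

(** The common length of [u 0] and [v 0], the unit of all block positions. *)
Definition block_size : nat := 3 * t + 3 * size w + 1.
Let L := block_size.

Lemma uv0E : u 0 = w ++ zeros t ++ w ++ zeros t.+1 ++ w ++ zeros t /\
  v 0 = w ++ zeros (3 * t + 2 * size w + 1).
Proof. by []. Qed.

Lemma uv1E : u 1 = u 0 ++ v 0 ++ u 0 /\ v 1 = u 0 ++ v 0.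
Proof. by []. Qed.

Lemma uvSSE k : u k.+2 = u k.+1 ++ v k.+1 ++ u k.+1 ++ u k.+1 /\
  v k.+2 = u k.+1 ++ v k.+1 ++ v k.+1 ++ u k.+1.
Proof.
have E : uv w t k.+2 = let: (u, v) := uv w t k.+1 in
  (u ++ v ++ u ++ u, u ++ v ++ v ++ u) by [].
by rewrite /u /v E; case: (uv w t k.+1).
Qed.

Lemma size_uv0 : size (u 0) = L /\ size (v 0) = L.
Proof. by rewrite /u /v /= /zeros !(size_cat, size_nseq) /= !(size_cat,
  size_nseq) /L /block_size; split; lia. Qed.

Lemma size_uvS k :
  size (u k.+1) = L * (vlen k + 1) /\ size (v k.+1) = L * vlen k.
Proof.
elim: k => [|k [IHu IHv]].
  have [S1 S2] := size_uv0; have [-> ->] := uv1E.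
  by rewrite (size_cat _ (v 0 ++ u 0)) (size_cat _ (u 0)) (size_cat _ (v 0)) S1
    S2 /=; lia.
by have [-> ->] := uvSSE k; rewrite !size_cat IHu IHv /=; lia.
Qed.

Definition block_word k (b : bool) : word := if b then u k else v k.

Lemma size_block_word k b :
  size (block_word k.+1 b) = L * (vlen k + b).
Proof. by have [S1 S2] := size_uvS k; case: b;
  rewrite [LHS]/= ?S1 ?S2 ?addn0. Qed.

Lemma limit_point_prefix k : occurs z 0 (u k).
Proof. by move=> i; rewrite add0n; exact: Defs.limit_pointP. Qed.

Lemma block_wordS k b : block_word k.+2 b =
  u k.+1 ++ v k.+1 ++ block_word k.+1 b ++ u k.+1.
Proof. by have [E1 E2] := uvSSE k; case: b. Qed.

(** Block [n] of level [k] is one of the four constituents of block [n %/ 4] of level [k + 1], so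
    the strong induction on [n] is uniform in [k]. *)
Lemma occurs_block k n :
  occurs z (L * block_pos k n) (block_word k.+1 (letter n)).
Proof.
elim/ltn_ind: n k => -[_ k|n IH k].
  rewrite muln0; exact: (limit_point_prefix k.+1).
have [m [r [E r4 mN]]] : exists m r, [/\ n.+1 = 4 * m + r, r < 4 & m < n.+1].
  exists (n.+1 %/ 4), (n.+1 %% 4); rewrite mulnC -divn_eq ltn_mod ltn_divLR //.
  by split=> //; lia.
have [Su Sv] := size_uvS k.
have := IH m mN k.+1.
rewrite -block_pos4 block_wordS =>
  /occurs_cat[H0 /occurs_cat[H1 /occurs_cat[H2 H3]]].
have pS j := block_posS k j.
rewrite E; case: r r4 {E} => [|[|[|[|//]]]] _.
- by rewrite addn0 letter4.
- rewrite letter4_1 addn1 pS letter4.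
  by move: H1; rewrite Su; congr occurs; lia.
- rewrite letter4_2 addn2 pS -[(4 * m).+1]addn1 letter4_1 addn1 pS letter4.
  by move: H2; rewrite Su Sv; congr occurs; lia.
- rewrite letter4_3 addn3 pS -[(4 * m).+2]addn2 letter4_2 addn2 pS.
  rewrite -[(4 * m).+1]addn1 letter4_1 addn1 pS letter4.
  by move: H3; rewrite Su Sv size_block_word; congr occurs; lia.
Qed.

(** Both u_(k+2) and v_(k+2) begin with u_(k+1). *)
Lemma occurs_u k n : occurs z (L * block_pos k.+1 n) (u k.+1).
Proof. by have := occurs_block k (4 * n); rewrite letter4 block_pos4. Qed.

Lemma occurs_aligned j : occurs z (L * j) (u 0) \/ occurs z (L * j) (v 0).
Proof.
have [n] := block_pos_between 0 j; rewrite block_posS /= => /andP[j1 j2].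
have [S1 S2] := size_uv0.
have : occurs z (L * block_pos 0 n) (u 0 ++ v 0 ++ if letter n then u 0 else
  [::]).
  by have := occurs_block 0 n; have [E1 E2] := uv1E; case: letter;
    rewrite /= ?cats0.
move=> /occurs_cat[H0 /occurs_cat[]]; rewrite S1 S2 => H1 H2.
have [e|ne] := eqVneq j (block_pos 0 n); first by left; rewrite e.
have [e|ne'] := eqVneq j (block_pos 0 n).+1.
  by right; rewrite e; move: H1; congr occurs; lia.
have e : j = (block_pos 0 n).+2 by move: j2; case: letter => /=; lia.
left; move: j2 H2; rewrite e; case: letter => /= j2; last by lia.
by congr occurs; lia.
Qed.

Lemma occurs_w j : occurs z (L * j) (w ++ zeros t).
Proof.
case: (occurs_aligned j); have [E1 E2] := uv0E; rewrite ?E1 ?E2.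
  by rewrite catA => /occurs_cat[].
have -> : 3 * t + 2 * size w + 1 = t + (2 * t + 2 * size w + 1) by lia.
by rewrite /zeros nseqD catA => /occurs_cat[].
Qed.

Let h := size w + t.

(** The gaps of t and t + 1 zeros in u_0 put its copies of [w] at distances [h] and [h + 1]; this
    difference of one is the source of thickness. *)
Lemma occurs_w3 : [/\ occurs z 0 w, occurs z h w & occurs z (2 * h + 1) w].
Proof.
have := limit_point_prefix 0; have [-> _] := uv0E.
move=> /occurs_cat[H0 /occurs_cat[_]].
move=> /occurs_cat[H1 /occurs_cat[_ /occurs_cat[H2 _]]].
rewrite !size_nseq in H1 H2; split => //.
by move: H2; congr occurs; rewrite /h; lia.
Qed.

Lemma limit_point_true q : z q -> exists2 Q, Q <= q < Q + size w & occurs z Q w.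
Proof.
move=> zq; have L0 : 0 < L by rewrite /L /block_size; lia.
set j := q %/ L; set r := q %% L.
have qE : q = L * j + r by rewrite mulnC -divn_eq.
have rL : r < L by rewrite ltn_mod.
rewrite qE in zq *.
have dich P a b : (forall i, i < b -> z (P + a + i) = false) ->
    P + a <= L * j + r < P + a + b -> False.
  move=> H ab; have /H : L * j + r - (P + a) < b by lia.
  by rewrite subnKC ?zq //; lia.
case: (occurs_aligned j); have [E1 E2] := uv0E; rewrite ?E1 ?E2.
  move=> /occurs_cat[A0 /occurs_cat[/occurs_zeros Z0]].
  move=> /occurs_cat[A1 /occurs_cat[/occurs_zeros Z1]].
  move=> /occurs_cat[A2 /occurs_zeros Z2]; rewrite !size_nseq in Z0 A1 Z1 A2 Z2.
  have [r1|r1] := ltnP r (size w); first by exists (L * j) => //; lia.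
  have [r2|r2] := ltnP r (size w + t); first by case: (dich _ _ _ Z0); lia.
  have [r3|r3] := ltnP r (size w + t + size w);
    first by exists (L * j + size w + t) => //; lia.
  have [r4|r4] := ltnP r (size w + t + size w + t.+1);
    first by case: (dich _ _ _ Z1); lia.
  have [r5|r5] := ltnP r (size w + t + size w + t.+1 + size w).
    by eexists; last exact: A2; lia.
  by case: (dich _ _ _ Z2); rewrite /L /block_size in rL; lia.
move=> /occurs_cat[A0 /occurs_zeros Z0].
have [r1|r1] := ltnP r (size w); first by exists (L * j) => //; lia.
by case: (dich _ _ _ Z0); rewrite /L /block_size in rL; lia.
Qed.

End Blocks.

(** * Proximal pairs in the basic subshifts *)

Definition agree (n : nat) (x y : nat -> bool) : Prop :=
  forall i, i < n -> x i = y i.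

Lemma nbhs_agree n (x : Sigma2) : nbhs x [set y : Sigma2 | agree n x y].
Proof.
apply: filterS (nbhs_entourage x (entourage_prefix n)) =>
  y /xsectionP /= xy i iN.
by apply: xy; exact: ltnW.
Qed.

Lemma nbhs_Sigma2P (x : Sigma2) (U : set Sigma2) :
  nbhs x U -> exists n, forall y : Sigma2, agree n x y -> U y.
Proof.
move=> /nbhsP[E /Sigma2_entourage[n nE] EU]; exists n.+1 => y xy; apply: EU.
by apply/xsectionP; apply: nE => i iN; exact: xy.
Qed.

Lemma closure_Sigma2P (A : set Sigma2) (x : Sigma2) :
  closure A x <-> forall n, exists2 y, A y & agree n x y.
Proof.
split=> [Ax n|H U /nbhs_Sigma2P[n nU]].
  by have [y [Ay xy]] := Ax _ (nbhs_agree n x); exists y.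
by have [y Ay xy] := H n; exists y; split => //; exact: nU.
Qed.

Lemma iter_sigmaE n (x : Sigma2) i : iter n sigma x i = x (n + i).
Proof. by elim: n i => // n IH i; rewrite iterS {1}/sigma IH addnS addSn. Qed.

Lemma orbit_closureP (z x : Sigma2) : closure (forward_orbit sigma z) x <->
  forall n, exists p, forall i, i < n -> x i = z (p + i).
Proof.
rewrite closure_Sigma2P; split=> H n; have [] := H n.
  by move=> _ [p _ <-] xy; exists p => i /xy; rewrite iter_sigmaE.
by move=> p xy; exists (iter p sigma z); [exists p|move=> i /xy;
  rewrite iter_sigmaE].
Qed.

(** If every [i] failed at some level, all would fail at the largest of these levels. *)
Lemma pigeonhole_antitone (P : nat -> nat -> Prop) r :
  (forall i n m, n <= m -> P i m -> P i n) ->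
  (forall n, exists2 i, i < r & P i n) ->
  exists2 i, i < r & forall n, P i n.
Proof.
move=> anti H; apply: contrapT => nP.
have /choice[f Pf] : forall i : 'I_r, exists n, ~ P i n.
  by move=> i; apply/existsNP => Pi; apply: nP; exists i.
have [i ir Pi] := H (\max_(i < r) f i).
by apply: (Pf (Ordinal ir)); apply: anti Pi; exact: (leq_bigmax (Ordinal ir)).
Qed.

Lemma Sigma2_proximal {R : realType} (x y : Sigma2) :
  (forall k, exists2 n, k <= n & forall i, i < k -> x (n + i) = y (n + i)) ->
  proximal (R := R) sigma x y.
Proof.
move=> H; have /choice[n nP] : forall k, exists n,
    k <= n /\ forall i, i < k -> x (n + i) = y (n + i).
  by move=> k; have [n kn xy] := H k; exists n.
exists n.
  apply/cvgnyPge => A; near=> k; have [kn _] := nP k.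
  by apply: leq_trans kn; near: k; exact: nbhs_infty_ge.
apply/cvgrPdist_lt => e e0.
have [m _ me] := near_infty_natSinv_expn_lt (PosNum e0).
near=> k; rewrite sub0r normrN ger0_norm ?mdist_ge0 //.
have mk : (m.+1 <= k)%N by near: k; exact: nbhs_infty_ge.
have [_ nk] := nP k.
apply: lt_trans (me m (leqnn m)); rewrite div1r.
apply/Sigma2_dist_ltP => i im; rewrite !iter_sigmaE; apply: nk.
exact: leq_trans mk.
Unshelve. all: by end_near. Qed.

Section BasicSubshift.
Variables (w : word) (t : nat).
Let z := Defs.limit_point w t.
Let u k := (uv w t k).1.
Let L := block_size w t.

Lemma block_size_gt0 : 0 < L.
Proof. by rewrite /L /block_size addn1. Qed.

(** The positions in [z] of longer and longer prefixes of [x] fall into [L] residue classes;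
    pigeonhole selects one for all lengths. *)
Lemma basic_subshift_aligned (x : Sigma2) : basic_subshift w t x ->
  exists2 r, r < L &
  forall n, exists j, forall i, i < n -> x i = z (r + L * j + i).
Proof.
move=> /orbit_closureP H.
apply: (@pigeonhole_antitone (fun r n => exists j, forall i,
  i < n -> x i = z (r + L * j + i))).
  by move=> r n m nm [j xj]; exists j => i iN; apply: xj; exact: leq_trans nm.
move=> n; have [p xp] := H n.
exists (p %% L); first by rewrite ltn_mod block_size_gt0.
by exists (p %/ L) => i /xp ->; rewrite mulnC [p %% L + _]addnC -divn_eq.
Qed.

(** Words u_(k+1) recur in [z] with bounded gaps, and a long prefix of [x] copies this. The
    condition [0 < q] ensures [r <= L * j]. *)
Lemma basic_subshift_syndetic (x : Sigma2) r k q : r < L -> 0 < q ->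
  (forall n, exists j, forall i, i < n -> x i = z (r + L * j + i)) ->
  exists j, [/\ q <= j <= q + (vlen k.+1 + 1), r <= L * j &
                occurs x (L * j - r) (u k.+1)].
Proof.
move=> rL q0 H; set G := vlen k.+1 + 1.
have [j0 xj0] := H (L * (q + G) + size (u k.+1)).
have [n /andP[n1 n2]] := block_pos_next k.+1 (j0 + q).
have zu := occurs_u w t k n; set b := block_pos k.+1 n in n1 n2 zu.
exists (b - j0).
have qj : q <= b - j0 <= q + G by rewrite /G; lia.
have Lj : L <= L * (b - j0) by rewrite leq_pmulr //; lia.
have Lj' : L * (b - j0) <= L * (q + G) by rewrite leq_mul2l; lia.
have LE : L * b = L * (b - j0) + L * j0 by rewrite -mulnDr; congr (_ * _); lia.
split => //; first by lia.
move=> i iu; rewrite xj0; last by lia.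
by rewrite -(zu i iu); congr (z _); rewrite -/L; lia.
Qed.

Lemma limit_point_prefix_occurs (x : nat -> bool) P k i :
  occurs x P (u k) -> i < k -> x (P + i) = z i.
Proof.
move=> xu ik; have ku : i < size (u k) by have [] := size_uv w t k;
  rewrite -/(u k); lia.
by rewrite xu // -(limit_point_prefix w t k).
Qed.

Section Proximal.
Variables (x : Sigma2) (r : nat).
Hypothesis rL : r < L.
Hypothesis xr : forall n, exists j, forall i, i < n -> x i = z (r + L * j + i).

(* Thickness of the return times to [u_K] meets their bounded gaps in [x]. *)
Lemma extend_word p l k : exists p' l' n,
  [/\ l <= l', k <= n, n + k <= l',
      forall i, i < l -> z (r + L * p' + i) = z (r + L * p + i) &
      forall i, i < k -> z (r + L * p' + (n + i)) = x (n + i)].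
Proof.
(* An occurrence of u_(K+1) reproduces the first K + 1 letters of [z], which covers all that is read
   below. *)
set K := r + L * p + l + k.
(* The differences fill an interval as long as the gaps of u_(K+1) in [x], so one of them is [p + j]
   with u_(K+1) at [L * j - r] in [x]. *)
have [m mB mP] := block_pos_thick K.+1 (vlen K.+1 + 1) (p + k + 1).
have q0 : 0 < m - p by lia.
have [j [/andP[j1 j2] rj xj]] := @basic_subshift_syndetic x r K _ rL q0 xr.
have [n1 [n2 nE]] := mP (j - (m - p)) (ltac:(lia)).
have z1 := occurs_u w t K n1; have z2 := occurs_u w t K n2.
rewrite -/z -/L in z1 z2.
have nE' : block_pos K.+1 n2 = block_pos K.+1 n1 + p + j by lia.
have Lj : L * k + L <= L * j by rewrite -mulnSr leq_mul2l; lia.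
have Lk : k <= L * k by rewrite leq_pmull // block_size_gt0.
(* Reading from [p] blocks after [n1] repeats the old word, and [j] blocks later the u_(K+1) at [n2]
   matches that of [x]. *)
exists (block_pos K.+1 n1 + p), (l + (L * j - r + k)), (L * j - r).
split; [lia|lia|lia| |] => i il.
  have -> : r + L * (block_pos K.+1 n1 + p) + i =
    L * block_pos K.+1 n1 + (r + L * p + i) by lia.
  by rewrite (limit_point_prefix_occurs _ _ z1) //; lia.
rewrite (limit_point_prefix_occurs _ _ xj); last by lia.
rewrite -(limit_point_prefix_occurs _ i z2); last by lia.
by congr (z _); rewrite nE' -/L; lia.
Qed.

(** Iterating [extend_word] with windows of agreement of lengths 1, 2, 3, ... gives words that
    extend one another and converge to [y]. *)
Lemma exists_proximal (R : realType) p l :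
  exists y : Sigma2, [/\ closure (forward_orbit sigma x) y,
    proximal (R := R) sigma x y &
    forall i, i < l -> y i = z (r + L * p + i)].
Proof.
have /choice[f fP] : forall s : nat * nat * nat, exists s' : nat * nat * nat,
  let: (p, l, k) := s in let: (p', l', n) := s' in
  [/\ l <= l', k <= n, n + k <= l',
      forall i, i < l -> z (r + L * p' + i) = z (r + L * p + i) &
      forall i, i < k -> z (r + L * p' + (n + i)) = x (n + i)].
  move=> [[p' l'] k]; have [p1 [l1 [n H]]] := extend_word p' l' k.
  by exists (p1, l1, n).
pose st := fix st k := if k is k'.+1 then let: (p, l, _) := st k' in f (p, l,
  k'.+1)
  else (p, l, 0).
pose pp k := (st k).1.1; pose ll k := (st k).1.2; pose nn k := (st k).2.
have stP k : [/\ ll k <= ll k.+1, k.+1 <= nn k.+1, nn k.+1 + k.+1 <= ll k.+1,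
      forall i, i < ll k -> z (r + L * pp k.+1 + i) = z (r + L * pp k + i) &
      forall i, i < k.+1 -> z (r + L * pp k.+1 + (nn k.+1 + i)) = x (nn k.+1 +
        i)].
  rewrite /pp /ll /nn /=; case: (st k) => -[a b] c /=.
  by have := fP (a, b, k.+1); case: (f _) => -[].
have kl k : k <= ll k by case: k => // k; have [] := stP k; lia.
have zk k j i : i < ll k ->
    ll k <= ll (k + j) /\ z (r + L * pp (k + j) + i) = z (r + L * pp k + i).
  move=> il; elim: j => [|j [IH1 IH2]]; first by rewrite addn0.
  rewrite addnS; have [h1 _ _ h2 _] := stP (k + j).
  by split; [lia|rewrite h2 ?IH2 //; lia].
(* Coordinate [i] is final from stage [i + 1] on, because [i < ll i.+1]. *)
pose y : Sigma2 := fun i => z (r + L * pp i.+1 + i).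
have yE k i : i < ll k -> y i = z (r + L * pp k + i).
  move=> il; rewrite /y; have [ki|ik] := leqP k i.+1.
    by have [_] := zk k (i.+1 - k) i il; rewrite subnKC.
  by have [|_] := zk i.+1 (k - i.+1) i; rewrite ?subnKC ?kl // ltnW.
exists y; split; last by move=> i il; exact: (yE 0).
- apply/orbit_closureP => n; set K := r + L * pp n + n.
  have [j [_ _ xj]] := @basic_subshift_syndetic x r K _ rL (ltn0Sn 0) xr.
  exists (L * j - r + (r + L * pp n)) => i iN.
  rewrite (@yE n); last by apply: leq_trans (kl n).
  by rewrite -[L * j - r + _ + i]addnA (limit_point_prefix_occurs _ _ xj) //;
    lia.
- apply: Sigma2_proximal => k; have [_ h1 h2 _ h3] := stP k.
  exists (nn k.+1); first by lia.
  by move=> i ik; rewrite (@yE k.+1) ?h3 //; lia.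
Qed.

End Proximal.

Lemma limit_point_nonperiodic : true \in w -> exists2 q, q < L &
  z (L * 1 + q) = false /\ z (L * 2 + q) = true.
Proof.
move=> tw; have [S1 S2] := size_uv0 w t; have [E0 E1] := uv0E w t.
have := limit_point_prefix w t 1; have [-> _] := uv1E w t.
move=> /occurs_cat[_ /occurs_cat[]]; rewrite S1 S2 E0 E1.
move=> /occurs_cat[_ /occurs_zeros zv] /occurs_cat[_ /occurs_cat[_
  /occurs_cat[zw _]]].
have ti : index true w < size w by rewrite index_mem.
(* The first 1 of the second copy of [w] in u_0, where v_0 has a zero; blocks 1 and 2 of u_1 are v_0
   and u_0. *)
exists (size w + t + index true w); first by rewrite /L /block_size; lia.
split.
  by rewrite -(zv (t + index true w)); [congr (z _); rewrite -/L; lia|lia].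
have := zw _ ti; rewrite nth_index // => zw1; rewrite -[RHS]zw1; congr (z _).
by rewrite size_nseq -/L; lia.
Qed.

Lemma basic_subshift_proximal (R : realType) (x : Sigma2) :
  true \in w -> basic_subshift w t x ->
  exists y : Sigma2, [/\ closure (forward_orbit sigma x) y, y <> x &
    proximal (R := R) sigma x y].
Proof.
move=> /limit_point_nonperiodic[q qL [z0 z1]] /basic_subshift_aligned[r rL xr].
have E p : r + L * p + (L - r + q) = L * p.+1 + q by rewrite mulnS; lia.
(* The choices 0 and 1 of [p] read blocks 1 and 2 at [q], whose letters differ, so one of them is
   not the letter of [x]. *)
have [p pP] : exists p, z (r + L * p + (L - r + q)) != x (L - r + q).
  have [e|e] := eqVneq (x (L - r + q)) true.
    by exists 0; rewrite E z0 e.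
  by exists 1; rewrite E z1 eq_sym.
have [y [xy pxy yE]] := @exists_proximal x r rL xr R p (L - r + q).+1.
exists y; split => // yx; move: pP.
by rewrite -yE // yx eqxx.
Qed.

End BasicSubshift.

(** * The language of the subshift XX *)

Lemma image_closure (f : Sigma2 -> Sigma2) (A : set Sigma2) :
  continuous f -> f @` closure A = closure (f @` A).
Proof.
move=> cf; apply/seteqP; split.
  move=> _ [x Ax <-] U fU; have [y [Ay Uy]] := Ax _ (cf _ _ fU).
  by exists (f y); split => //; exists y.
have cA : compact (closure A).
  by apply: subclosed_compact cantor_space_compact _ => //;
    exact: closed_closure.
have /compact_closed : compact (f @` closure A).
  by apply: continuous_compact => //; exact: continuous_subspaceT.
move=> /(_ (cantor_space_hausdorff))/closure_id ->.
by apply: closureS; apply: image_subset; exact: subset_closure.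
Qed.

Lemma iter_sigma_continuous n : continuous (iter n sigma).
Proof.
elim: n => [|n IH] x; first exact: cvg_id.
by apply: continuous_comp (IH x) _; exact: sigma_continuous.
Qed.

Definition power_orbit (p : nat) (z : Sigma2) : set Sigma2 :=
  [set iter (p * j) sigma z | j in [set: nat]].

Lemma power_orbit1 z : power_orbit 1 z = forward_orbit sigma z.
Proof.
by apply/seteqP; split => _ [j _ <-]; exists j => //; rewrite mul1n.
Qed.

(** Recurrence makes the starting point [z] a limit of points of the image, which gives
    surjectivity. *)
Lemma power_orbit_closure p z :
  (forall n, exists j, forall i, i < n -> z (p * j.+1 + i) = z i) ->
  iter p sigma @` closure (power_orbit p z) = closure (power_orbit p z).
Proof.
move=> H; rewrite image_closure; last exact: iter_sigma_continuous.
apply/seteqP; split.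
  apply: closureS => _ [_ [j _ <-] <-]; exists j.+1 => //.
  by rewrite mulnS iterD.
rewrite [X in _ `<=` X](closure_id _).1; last exact: closed_closure.
apply: closureS => _ [[|j] _ <-].
  rewrite muln0; apply/closure_Sigma2P => n; have [j jP] := H n.
  exists (iter (p * j.+1) sigma z); last by move=> i /jP;
    rewrite !iter_sigmaE add0n => ->.
  by exists (iter (p * j) sigma z); [exists j|rewrite -iterD -mulnS].
apply: subset_closure; exists (iter (p * j) sigma z); first by exists j.
by rewrite -iterD -mulnS.
Qed.

Lemma limit_point_recurrent w t n : exists j, forall i, i < n ->
  Defs.limit_point w t (block_size w t * j.+1 + i) = Defs.limit_point w t i.
Proof.
have H := occurs_u w t n 1; have := vlen_ge n.+1.
case E : (block_pos n.+1 1) => [|j]; first by move: E; rewrite /block_pos; lia.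
by rewrite E in H; exists j => i iN;
  rewrite (limit_point_prefix_occurs _ _ _ _ H) //; lia.
Qed.

Lemma sigma_basic_subshift w t : sigma @` basic_subshift w t = basic_subshift w
  t.
Proof.
rewrite /basic_subshift -power_orbit1 (@power_orbit_closure 1) // => n.
have [j jP] := limit_point_recurrent w t n; have L0 := block_size_gt0 w t.
exists (block_size w t * j.+1).-1 => i /jP <-; congr (Defs.limit_point _ _ _).
by rewrite mul1n prednK // muln_gt0 L0.
Qed.

Lemma split_flatten (ss : seq word) i : i < size (flatten ss) ->
  exists s1 s s2, ss = s1 ++ s :: s2 /\
    size (flatten s1) <= i < size (flatten s1) + size s.
Proof.
elim: ss i => //= s ss IH i; rewrite size_cat => iss.
have [lt|le] := ltnP i (size s); first by exists [::], s, ss.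
have /IH[s1 [s' [s2 [-> H]]]] : i - size s < size (flatten ss) by lia.
by exists (s :: s1), s', s2; rewrite /= size_cat; split => //; lia.
Qed.

Definition contains_at (c : word) (q : nat) (a : word) : Prop :=
  forall (x : nat -> bool) P, occurs x P c -> occurs x (P + q) a.

Section Construction.
Variables (w : nat -> word) (t : nat -> nat) (e : nat -> seq word).
Variable (R : realType).
Hypothesis c : construction w t e R.
Let z n := Defs.limit_point (w n) (t n).

(** These are the words of the language of [XX], by [admissible_XX] and [XX_admissible]. *)
Definition admissible (a : word) : Prop :=
  exists n p, 0 < n /\ occurs (z n) p a.

Lemma limit_point_MM n p : MM w t n (iter p sigma (z n)).
Proof. by apply: subset_closure; exists p. Qed.

Lemma MM_XX n x : 0 < n -> MM w t n x -> XX w t x.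
Proof. by move=> n0 Mx; apply: subset_closure; exists n. Qed.

Lemma XXP x : XX w t x <-> forall l, exists n p, 0 < n /\
  forall i, i < l -> x i = z n (p + i).
Proof.
rewrite /XX closure_Sigma2P; split => H l.
  have [y [n n0 /orbit_closureP/(_ l)[p yp]] xy] := H l.
  by exists n, p; split => // i il; rewrite xy // yp.
have [n [p [n0 xn]]] := H l; exists (iter p sigma (z n)).
  by exists n => //; exact: limit_point_MM.
by move=> i /xn; rewrite iter_sigmaE.
Qed.

Lemma admissible_XX a : admissible a -> exists2 x, XX w t x & occurs x 0 a.
Proof.
move=> [n [p [n0 za]]]; exists (iter p sigma (z n)).
  by apply: MM_XX n0 _; exact: limit_point_MM.
by move=> i ia; rewrite iter_sigmaE add0n za.
Qed.

Lemma XX_admissible x l : XX w t x -> admissible (mkseq x l).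
Proof.
move=> /XXP/(_ l)[n [p [n0 xn]]]; exists n, p; split => // i.
by rewrite size_mkseq => il; rewrite nth_mkseq // xn.
Qed.

Lemma true_in_w n : 0 < n -> true \in w n.
Proof.
(* Without a 1 in [w n] the last inequality of [gap] would have right-hand side 0. *)
move=> /(t_gap c)[_ _]; apply: contraTT => /count_memPn.
by rewrite /ones => ->; rewrite mul0r -leNgt divr_ge0.
Qed.

(** Once [n] is at least [i + size a], the factor of [z i] of length [n] starting at the occurrence
    of [a] is enumerated in [w n.+1]. *)
Lemma contains_at_w a : admissible a -> exists N, forall n, N <= n ->
  exists2 q, q <= size (w n.+1) & contains_at (w n.+1) q a.
Proof.
move=> [i [p [i0 za]]]; exists (i + size a) => n iN.
set U := mkseq (fun j => z i (p + j)) n.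
have n0 : 0 < n by lia.
have : U \in e n.
  apply/(e_enum c n0); exists (z i); last by exists p.
  by exists i; [rewrite /=; lia|exact: (limit_point_MM i 0)].
rewrite (w_succ c n0) => /splitPr[s1 s2]; rewrite map_cat /= flatten_cat /=.
exists (size (flatten [seq u ++ zeros (n * 9 ^ n) | u <- s1])).
  by rewrite size_cat leq_addr.
move=> x P /occurs_cat[_ /occurs_cat[/occurs_cat[xU _] _]] j ja.
have jn : j < n by lia.
by rewrite xU ?size_mkseq // nth_mkseq ?za.
Qed.

Lemma contains_at_w_all (s : seq word) : (forall a, a \in s -> admissible a) ->
  exists N, forall n, N <= n -> forall a, a \in s ->
  exists2 q, q <= size (w n.+1) & contains_at (w n.+1) q a.
Proof.
elim: s => [|b s IH] H; first by exists 0.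
have [N1 N1P] : exists N, forall n, N <= n -> forall a, a \in s ->
    exists2 q, q <= size (w n.+1) & contains_at (w n.+1) q a.
  by apply: IH => a sa; apply: H; rewrite inE sa orbT.
have [N2 N2P] := contains_at_w (H b (mem_head b s)).
exists (N1 + N2) => n Nn a; rewrite inE => /predU1P[->|]; first by apply: N2P;
  lia.
by apply: N1P; lia.
Qed.

Lemma contains_at_w_size l : exists2 n, 0 < n &
  forall a, admissible a -> size a = l ->
  exists2 q, q <= size (w n) & contains_at (w n) q a.
Proof.
pose s := [seq a <- [seq tval u | u : l.-tuple bool] | `[< admissible a >]].
have [|N NP] := @contains_at_w_all (s).
  by move=> a; rewrite mem_filter => /andP[/asboolP].
exists N.+1 => // a La al; apply: NP => //; rewrite mem_filter; apply/andP;
  split.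
  exact/asboolP.
by rewrite -al; apply/mapP; exists (in_tuple a) => //; rewrite mem_enum.
Qed.

(** By [limit_point_true] the 1 lies in a copy of [w n.+1], outside the separators, hence in an
    enumerated word; the next separator has n 9^n >= n zeros. *)
Lemma limit_point_slot n q : 0 < n -> z n.+1 q -> exists P,
  [/\ P <= q < P + n,
      exists i p, 0 < i <= n /\ forall j,
        j < n -> z n.+1 (P + j) = z i (p + j) &
      forall j, j < n -> z n.+1 (P + n + j) = false].
Proof.
move=> n0 zq; have [Q /andP[Qq qQ]] := limit_point_true _ _ _ zq.
rewrite -/(z n.+1) => zQ; rewrite (w_succ c n0) in qQ zQ.
have /split_flatten[s1 [s [s2 [E /andP[iq qi]]]]] :
  q - Q < size (flatten [seq u ++ zeros (n * 9 ^ n) | u <- e n]) by lia.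
have := @occurs_flatten (z n.+1) Q _ s1 s s2 zQ E; set P := Q + _.
have : s \in [seq u ++ zeros (n * 9 ^ n) | u <- e n] by rewrite E mem_cat
  mem_head orbT.
move=> /mapP[u /(e_enum c n0)[x [i /= i0n Mx] [p0 uE]] sE]; rewrite sE.
have un : size u = n by rewrite uE size_mkseq.
move=> /occurs_cat[zu /occurs_zeros z0]; rewrite un in z0.
have nn : n <= n * 9 ^ n by rewrite leq_pmulr // expn_gt0.
exists P; split.
- rewrite sE size_cat un size_nseq in qi.
  have PE : P = Q + size (flatten s1) by [].
  apply/andP; split; first by lia.
  rewrite ltnNge; apply/negP => Pq.
  have /z0 : q - (P + n) < n * 9 ^ n by lia.
  by rewrite subnKC // zq.
- have /orbit_closureP/(_ (p0 + n))[p xp] := Mx.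
  exists i, (p + p0); split; first by [].
  move=> j jn; rewrite zu ?un // uE nth_mkseq // xp; last by lia.
  by rewrite addnA.
- by move=> j jn; apply: z0; lia.
Qed.

(* A factor of [z (n+1)] that begins and ends with 1 and has no run of [r <= n]
   zeros lies in one of the words enumerated in [w (n+1)], hence occurs in some
   [z i] with [i <= n]. *)
Lemma descend r (x : nat -> bool) l n p : x 0 -> x l ->
  (forall q, q + r <= l -> exists2 j, j < r & x (q + j)) ->
  0 < n -> (forall j, j <= l -> x j = z n (p + j)) ->
  exists i p', 0 < i <= r.+1 /\ forall j, j <= l -> x j = z i (p' + j).
Proof.
move=> x0 xl xr; elim/ltn_ind: n p => n IH p n0 xn.
have [nr|rn] := leqP n r.+1; first by exists n, p; rewrite n0 nr.
case: n rn IH n0 xn => // n rn IH _ xn.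
have n0 : 0 < n by lia.
have zp : z n.+1 p by move: (xn 0 (leq0n l)); rewrite addn0 x0.
have [P [/andP[Pp pP] [i [p' [i0n zi]]] z0]] := limit_point_slot _ _ n0 zp.
(* If the factor left the slot, its last 1 would lie beyond the [n] zeros, so it would contain a run
   of [r] zeros. *)
have lP : p + l < P + n.
  rewrite ltnNge; apply/negP => Pl.
  have zpl : z n.+1 (p + l) by rewrite -xn.
  have Pnl : P + n + n <= p + l.
    rewrite leqNgt; apply/negP => lt.
    have := z0 (p + l - (P + n)); rewrite subnKC // zpl => H.
    by have /H : p + l - (P + n) < n by lia.
  have [|j jr] := xr (P + n - p); first by lia.
  rewrite xn; last by lia.
  have -> : p + (P + n - p + j) = P + n + j by lia.
  by rewrite z0 //; lia.
apply: (IH i _ (p' + (p - P))); [lia|lia|move=> j jl].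
rewrite xn //; have -> : p + j = P + (p - P + j) by lia.
by rewrite zi; [rewrite addnA|lia].
Qed.

(** [descend], applied to prefixes of [x] that end with 1, bounds the index by [r + 1]; pigeonhole
    then selects one index for all lengths. *)
Lemma XX_bounded_runs r x : XX w t x -> x 0 ->
  (forall q, exists2 j, j < r & x (q + j)) ->
  exists2 n, 0 < n & MM w t n x.
Proof.
move=> Xx x0 xr.
have H l : exists2 n, n < r.+2 &
    0 < n /\ exists p, forall i, i < l -> x i = z n (p + i).
  have [j jr xj] := xr l; have [n [p [n0 xn]]] := (XXP x).1 Xx (l + j).+1.
  have [i [p' [/andP[i0 ir] xi]]] :=
    @descend r x (l + j) n p x0 xj (fun q _ => xr q) n0 xn.
  by exists i => //; split => //; exists p' => k kl; apply: xi; lia.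
have [|n _ nP] := @pigeonhole_antitone _ _ _ H.
  by move=> n a b ab [n0 [p xp]]; split => //; exists p => i ia; apply: xp; lia.
exists n; first by have [] := nP 0.
by apply/orbit_closureP => l; have [] := nP l.
Qed.

Lemma iter_sigma_XX p x : XX w t x -> XX w t (iter p sigma x).
Proof.
move=> /XXP H; apply/XXP => l; have [n [q [n0 xn]]] := H (p + l).
exists n, (q + p); split => // i il; rewrite iter_sigmaE xn ?addnA //.
by rewrite ltn_add2l.
Qed.

Lemma sigma_XX : sigma @` XX w t = XX w t.
Proof.
rewrite /XX image_closure; last exact: sigma_continuous.
congr closure; apply/seteqP; split.
  move=> _ [x [n n0 Mx] <-]; exists n => //.
  by rewrite /MM -sigma_basic_subshift; exists x.
move=> x [n n0]; rewrite /MM -sigma_basic_subshift => -[y My <-].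
by exists y => //; exists n.
Qed.

Lemma XX_compact : compact (XX w t).
Proof.
apply: subclosed_compact cantor_space_compact _ => //; exact: closed_closure.
Qed.

Lemma not_dense_distal : ~ dense_distal_points (R := R) (XX w t) sigma.
Proof.
(* As w_1 begins with 01, this point begins with 1, and density gives a distal [x] beginning with
   1. *)
have Xz : XX w t (iter 1 sigma (z 1)) by apply: (@MM_XX 1) => //;
  exact: limit_point_MM.
move=> /(_ _ Xz)/closure_Sigma2P/(_ 1)[x [Xx dx] /(_ 0 erefl)].
have [z0 _ _] := occurs_w3 (w 1) (t 1).
rewrite iter_sigmaE /z -[1 + 0]add0n z0 ?(w_1 c) //= => /esym x0.
have [[r xr]|H] := pselect (exists r, forall q, exists2 j, j < r & x (q + j)).
  have [n n0 Mx] := XX_bounded_runs _ Xx x0 xr.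
  have [y [cy yx pxy]] := basic_subshift_proximal R (true_in_w _ n0) Mx.
  exact: dx pxy.
have run r : exists q, forall j, j < r -> x (q + j) = false.
  apply: contrapT => nq; apply: H; exists r => q; apply: contrapT => nj.
  by apply: nq; exists q => j jr; apply/negbTE/negP => xj; apply: nj; exists j.
apply: (dx (fun=> false)).
- apply/orbit_closureP => n; have [q qP] := run n.
  by exists q => i iN; rewrite qP.
- by move=> E; move: x0; rewrite -E.
(* The second half of a run of 2k zeros starts at a time at least [k]. *)
- apply: Sigma2_proximal => k; have [q qP] := run (k + k).
  exists (q + k); first by rewrite leq_addl.
  by move=> i ik; rewrite -addnA qP //; lia.
Qed.

(* In [z n] the word [w n] returns at times h and h + 1: each application of
   this widens by one the interval of return times of a word. *)
Lemma return_times_thick a r : admissible a -> exists2 H, r <= H &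
  forall i, i <= r -> exists b,
  [/\ admissible b, contains_at b 0 a & contains_at b (H + i) a].
Proof.
move=> La; elim: r => [|r [H rH HP]].
  exists 0 => // i; rewrite leqn0 => /eqP ->; exists a; split => //;
    by move=> x P xa; rewrite !addn0.
have /choice[b bP] : forall i, exists b, i <= r ->
    [/\ admissible b, contains_at b 0 a & contains_at b (H + i) a].
  move=> i; have [ir|//] := leqP i r; last by exists a.
  by have [b bP] := HP i ir; exists b.
have [|N NP] := @contains_at_w_all ([seq b i | i <- iota 0 r.+1]).
  by move=> d /mapP[i]; rewrite mem_iota => /andP[_ ir] ->; have [] := bP i ir.
have {NP} NP i : i <= r -> exists2 q,
  q <= size (w N.+1) & contains_at (w N.+1) q (b i).
  by move=> ir; apply: NP => //; apply: map_f; rewrite mem_iota.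
set n := N.+1 in NP; set h := size (w n) + t n.
have [z0 z1 z2] := occurs_w3 (w n) (t n); rewrite -/(z n) -/h in z0 z1 z2.
have h0 : 0 < h.
  have := true_in_w _ (ltn0Sn N); rewrite /h /n; case: (w N.+1) => //=; lia.
have key q1 q2 : occurs (z n) q1 a -> occurs (z n) (q1 + q2) a -> exists b,
    [/\ admissible b, contains_at b 0 a & contains_at b q2 a].
  move=> za1 za2; exists (mkseq (fun j => z n (q1 + j)) (q2 + size a)); split.
  - by exists n, q1; split => //; apply/occurs_mkseq.
  - move=> x P /occurs_mkseq xz j ja; rewrite addn0 xz; last by lia.
    by rewrite za1.
  - move=> x P /occurs_mkseq xz j ja; rewrite -addnA xz; last by lia.
    by rewrite addnA za2.
exists (H + h); first by lia.
(* Copies of [w n] at distance [h] turn the return times H + i into H + h + i; those at distance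
   [h + 1], with i = r, supply the new last value. *)
move=> i ir1; have [ir|ri] := leqP i r.
  have [q _ wb] := NP i ir; have [_ b0 b1] := bP i ir.
  apply: (key q).
    by have := b0 _ _ (wb _ _ z0); rewrite add0n addn0.
  by have := b1 _ _ (wb _ _ z1); congr occurs; lia.
have [q _ wb] := NP r (leqnn r); have [_ b0 b1] := bP r (leqnn r).
apply: (key (h + q)).
  by have := b0 _ _ (wb _ _ z1); rewrite addn0.
by have := b1 _ _ (wb _ _ z2); congr occurs; lia.
Qed.

(** One [w n] contains all admissible words of length [l], so its return times serve all pairs at
    once; the extra length [2 * s] absorbs the offsets [qa] and [qb]. *)
Lemma XX_thick l r : exists2 H, r <= H & forall i, i <= r ->
  forall a b, admissible a -> admissible b -> size a = l -> size b = l ->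
  exists x, [/\ XX w t x, occurs x 0 a & occurs x (H + i) b].
Proof.
have [n n0 nP] := contains_at_w_size l; set s := size (w n) in nP.
have Lw : admissible (w n).
  by exists n, 0; split => //; have [] := occurs_w3 (w n) (t n).
have [H rH HP] := return_times_thick (r + 2 * s) Lw.
exists (H + s); first by lia.
move=> i ir a b La Lb al bl.
have [qa qas wa] := nP a La al; have [qb qbs wb] := nP b Lb bl.
have [|d [Ld d0 d1]] := HP (s + i + qa - qb); first by lia.
have [y Xy yd] := admissible_XX Ld.
exists (iter qa sigma y); split; first exact: iter_sigma_XX.
  move=> j ja; rewrite iter_sigmaE -(wa _ _ (d0 _ _ yd)) //.
move=> j jb; rewrite iter_sigmaE -(wb _ _ (d1 _ _ yd)) //.
by congr (y _); lia.
Qed.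

(** Since [w n] occurs in [z n] at all multiples of [L], the orbit closure of [z n] under sigma^L,
    shifted to the offset of [a], serves; [L] is common to all words of length [l]. *)
Lemma XX_periodic l : exists2 p, 0 < p &
  forall a, admissible a -> size a = l -> exists D : set Sigma2,
  [/\ D !=set0, closed D, D `<=` XX w t, iter p sigma @` D = D &
      forall x, D x -> occurs x 0 a].
Proof.
have [n n0 nP] := contains_at_w_size l; set L := block_size (w n) (t n).
exists L; first exact: block_size_gt0.
move=> a La al; have [q _ wa] := nP a La al.
pose D0 := closure (power_orbit L (z n)); exists (iter q sigma @` D0).
have D0D : iter L sigma @` D0 = D0.
  by apply: power_orbit_closure; exact: limit_point_recurrent.
split.
- by exists (iter q sigma (z n)), (z n) => //; apply: subset_closure;
    exists 0; rewrite ?muln0.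
- rewrite /D0 image_closure; first exact: closed_closure.
  exact: iter_sigma_continuous.
- move=> _ [x Dx <-]; apply: iter_sigma_XX; apply: (@MM_XX n) => //.
  by apply: closureS Dx => _ [j _ <-]; exists (L * j).
- rewrite -[in RHS]D0D !image_comp.
  by apply: eq_imagel => x _ /=; rewrite -!iterD addnC.
- move=> _ [x /closure_Sigma2P Dx <-] i ia.
  have [_ [j _ <-] xj] := Dx (q + i).+1.
  rewrite iter_sigmaE xj // iter_sigmaE.
  have /occurs_cat[zw _] := occurs_w (w n) (t n) j.
  by have := wa _ _ zw i ia; rewrite -addnA.
Qed.

End Construction.

(** * Disjointness from minimal systems *)

Lemma within_nbhs_continuous {S T : topologicalType} (Y : set S) (g : S -> T) y
    (U : set T) : {within Y, continuous g} -> Y y -> nbhs (g y) U ->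
  exists2 V, nbhs y V & forall y', V y' -> Y y' -> U (g y').
Proof.
move=> /subspace_continuousP cg Yy gU.
by exists [set y' | Y y' -> U (g y')]; [exact: cg gU|move=> y' /[swap] Yy';
  apply].
Qed.

Lemma iter_stable {S : Type} (Y : set S) (g : S -> S) n y :
  (forall y, Y y -> Y (g y)) -> Y y -> Y (iter n g y).
Proof. by move=> gY Yy; elim: n => //= n; exact: gY. Qed.

Lemma iter_within_continuous {S : topologicalType} (Y : set S) (g : S -> S) n :
  {within Y, continuous g} -> (forall y, Y y -> Y (g y)) ->
  {within Y, continuous (iter n g)}.
Proof.
move=> cg gY; elim: n => [|n IH]; first by apply: continuous_subspaceT => x;
  exact: cvg_id.
apply/subspace_continuousP => y Yy U gU.
have Yn : Y (iter n g y) by exact: (@iter_stable _ Y g).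
have [V Vg VU] := @within_nbhs_continuous _ _ Y g _ U cg Yn gU.
have [W Wy WV] := @within_nbhs_continuous _ _ Y (iter n g) _ V IH Yy Vg.
apply: filterS Wy => y' Wy' Yy'; apply: VU; first exact: WV.
exact: (@iter_stable _ Y g).
Qed.

(** * Minimal sets of powers *)

Section MinimalPowers.
Context {S : topologicalType}.
Variables (Y : set S) (g : S -> S).
Hypothesis cY : compact Y.
Hypothesis cg : {within Y, continuous g}.
Hypothesis gY : forall y, Y y -> Y (g y).
Hypothesis Y0 : Y !=set0.

Lemma iter_in n y : Y y -> Y (iter n g y).
Proof. exact: (@iter_stable _ Y g). Qed.

Lemma iter_near n y (U : set S) : Y y -> nbhs (iter n g y) U ->
  exists2 V, nbhs y V & forall y', V y' -> Y y' -> U (iter n g y').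
Proof. by apply: within_nbhs_continuous; exact: iter_within_continuous. Qed.

(* [Y `\` A] is a minimal closed set invariant under the [p]-th power. *)
Lemma exists_minimal_power p : exists A, [/\ open A, exists2 y, Y y & ~ A y,
  forall y, Y y -> ~ A y -> ~ A (iter p g y) &
  forall x y, Y x -> ~ A x -> Y y -> ~ A y -> forall U, nbhs y U ->
    exists k, U (iter (p * k) g x)].
Proof.
pose P (A : set S) := [/\ open A, exists2 y, Y y & ~ A y &
  forall y, Y y -> ~ A y -> ~ A (iter p g y)].
(* Passing to open complements turns intersections of chains into unions. *)
have [F FP Ftot|A [[Ao Ay Ap] Amax]] := @Zorn_bigcup S P.
  split.
  - by apply: bigcup_open => B /FP[].
  - apply: contrapT => nF.
    have YF y : Y y -> exists2 B, F B & B y.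
      by move=> Yy; apply: contrapT => nB; apply: nF; exists y.
    have [y0 Yy0] := Y0; have [B0 FB0 _] := YF y0 Yy0.
    (* If the union covered [Y], compactness along the filter of upper sections of the chain would
       make a single member cover [Y]. *)
    have FF : ProperFilter (filter_from F (fun B => [set C | F C /\ B `<=` C])).
      apply: filter_from_proper; last by move=> B FB; exists B; split.
      apply: filter_from_filter; first by exists B0.
      move=> B C FB FC; have [BC|CB] := Ftot _ _ FB FC.
        by exists C => // D [FD CD]; split; split => //; exact: subset_trans CD.
      by exists B => // D [FD BD]; split; split => //; exact: subset_trans BD.
    move/compact_near_coveringP: cY.
    move=> near_cover; have H : forall y, Y y -> \forall y' \near y & C \near
        filter_from F (fun B => [set C | F C /\ B `<=` C]), C y'.
      move=> y /YF[B FB By]; have [Bo _ _] := FP _ FB.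
      exists (B, [set C | F C /\ B `<=` C]) => /=.
        by split; [exact: open_nbhs_nbhs|exists B].
      by move=> [y' C] [/= By' [_]]; apply.
    have [B FB] := near_cover _ _ (fun C y => C y) _ H.
    have [_ [y Yy nBy] _] := FP _ FB; move=> /(_ B) /=.
    by move=> /(_ (conj FB (@subset_refl _ B)))/(_ y Yy).
  - move=> y Yy nFy [B FB /=]; have [_ _ Bp] := FP _ FB.
    by apply: Bp => // By; apply: nFy; exists B.
exists A; split => // x y Yx nAx Yy nAy U yU.
apply: contrapT => nU.
pose O := [set iter (p * k) g x | k in [set: nat]].
have nAk k : ~ A (iter (p * k) g x).
  elim: k => [|k IH]; first by rewrite muln0.
  by rewrite mulnS iterD; apply: Ap => //; exact: iter_in.
(* Adding the complement of the orbit closure of [x] would enlarge [A] by [y], against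
   maximality. *)
apply: (Amax (A `|` ~` closure O)).
  split; first by move=> z Az; left.
  move=> /(_ y) H; apply: nAy; apply: H; right => /(_ _ yU).
  by move=> [_ [[k _ <-] Uk]]; apply: nU; exists k.
split.
- by apply: openU => //; apply: closed_openC; exact: closed_closure.
- exists x => // -[//|]; apply; apply: subset_closure; exists 0 => //.
  by rewrite muln0.
- move=> z Yz /not_orP[nAz /contrapT Oz] [|]; first exact: Ap.
  apply=> V zV; have [W Wz WV] := @iter_near _ _ _ Yz zV.
  have [_ [[k _ <-] Wk]] := Oz _ Wz.
  exists (iter (p * k.+1) g x); split; first by exists k.+1.
  by rewrite mulnS iterD; apply: WV => //; exact: iter_in.
Qed.

(** Every orbit leaves [A] within [p] steps; from outside [A], minimality for the [p]-th power leads
    to [W] at times in a fixed class modulo [p], and compactness bounds the wait. *)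
Lemma minimal_progressions p (W : set S) :
  (forall x y, Y x -> Y y -> forall U, nbhs y U -> exists m, U (iter m g x)) ->
  0 < p -> open W -> (exists2 y, Y y & W y) -> exists N, forall y, Y y ->
  exists2 r, r < p & forall n, 2 * p <= n -> n = r %[mod p] ->
  exists2 k, k <= N & W (iter (n + p * k) g y).
Proof.
move=> Ymin p0 Wo [y1 Yy1 Wy1].
have [A [Ao [y0 Yy0 nAy0] Ap Amin]] := exists_minimal_power p.
have Apk k y : Y y -> ~ A y -> ~ A (iter (p * k) g y).
  move=> Yy nAy; elim: k => [|k IH]; first by rewrite muln0.
  by rewrite mulnS iterD; apply: Ap => //; exact: iter_in.
have hit y : Y y -> exists2 i, i < p & ~ A (iter i g y).
  move=> Yy; apply: contrapT => nA.
  have Ai i : i < p -> A (iter i g y).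
    by move=> ip; apply: contrapT => nAi; apply: nA; exists i.
  have : \forall y' \near y, forall i : 'I_p, Y y' -> A (iter i g y').
    apply: filter_forall => i.
    have [V Vy VA] := @iter_near _ _ _ Yy (open_nbhs_nbhs (conj Ao (Ai i
      (ltn_ord i)))).
    by apply: filterS Vy => y' Vy' Yy'; exact: VA.
  move=> /(Ymin _ _ Yy0 Yy)[m mA].
  (* At time [m] the orbit of [y0] is near [y]; completing [m] to a multiple of [p] would bring [y0]
     into [A], which [Apk] forbids. *)
  have ip : (p - m %% p) %% p < p by rewrite ltn_mod.
  have /(_ (@iter_in _ _ Yy0)) := mA (Ordinal ip); rewrite -iterD /=.
  have : p %| (p - m %% p) %% p + m.
    rewrite /dvdn modnDml -modnDmr subnK ?modnn //.
    by rewrite ltnW // ltn_mod.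
  by move=> /dvdnP[k ->]; rewrite mulnC; exact: Apk.
have [m Wm] := Ymin _ _ Yy0 Yy1 _ (open_nbhs_nbhs (conj Wo Wy1)).
set i0 := m %% p.
have i0p : i0 < p by rewrite ltn_mod.
pose e0 := iter (p * (m %/ p)) g y0.
have Ye0 : Y e0 by exact: iter_in.
have We0 : W (iter i0 g e0).
  by rewrite -iterD mulnC addnC -divn_eq.
have reach x : Y x -> ~ A x -> exists k, W (iter (i0 + p * k) g x).
  move=> Yx nAx.
  have [V Ve VW] := @iter_near _ _ _ Ye0 (open_nbhs_nbhs (conj Wo We0)).
  have [k Vk] := Amin _ _ Yx nAx Ye0 (Apk _ _ Yy0 nAy0) _ Ve.
  by exists k; rewrite iterD; apply: VW => //; exact: iter_in.
have [N NP] : exists N, forall x, Y x -> ~ A x ->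
    exists2 k, k <= N & W (iter (i0 + p * k) g x).
  have /compact_near_coveringP near_cover := cY.
  have H : forall x, Y x -> \forall x' \near x & N \near \oo, Y x' -> ~ A x' ->
    exists2 k, k <= N & W (iter (i0 + p * k) g x').
    move=> x Yx; have [Ax|nAx] := pselect (A x).
      exists (A, setT) => /=; first by split;
        [exact: open_nbhs_nbhs|exact: filterT].
      by move=> [x' N] [/= Ax' _] _ /(_ Ax').
    have [k Wk] := reach x Yx nAx.
    have [V Vx VW] := @iter_near _ _ _ Yx (open_nbhs_nbhs (conj Wo Wk)).
    exists (V, [set N | k <= N]) => /=; first by split => //;
      exact: nbhs_infty_ge.
    by move=> [x' N] [/= Vx' kN] Yx' _; exists k => //; exact: VW.
  have [N _ /(_ N (leqnn N)) NP] := near_cover _ \oo (fun N x' =>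
    Y x' -> ~ A x' ->
    exists2 k, k <= N & W (iter (i0 + p * k) g x')) _ H.
  by exists N => x Yx; exact: (NP x Yx Yx).
exists N => y Yy; have [i ip nAi] := hit y Yy.
exists ((i0 + i) %% p); first by rewrite ltn_mod.
move=> n pn; rewrite modn_mod => nE.
(* Both [i0] and [i] are below [p], hence the bound [2 * p] on [n]. *)
have in0 : i0 + i <= n by lia.
have /dvdnP[q qE] : p %| n - (i0 + i).
  by rewrite -eqn_mod_dvd //; apply/eqP.
have nE' : n = i0 + (p * q + i) by rewrite mulnC -qE; clear -in0; lia.
have Yi := @iter_in i _ Yy.
have [k kN Wk] := NP _ (@iter_in (p * q) _ Yi) (Apk q _ Yi nAi).
exists k => //; move: Wk; rewrite -!iterD.
by congr (W (iter _ g y)); lia.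
Qed.

End MinimalPowers.

(** * A disjointness criterion *)

Section Disjoint.
Context {R : realType} {T S : metricType R}.
Variables (X : set T) (f : T -> T).
Hypothesis cf : continuous f.
Hypothesis thick : forall U V, open U -> open V -> X `&` U !=set0 ->
  X `&` V !=set0 -> forall r, exists2 H, r <= H & forall i, i <= r ->
  exists x, [/\ X x, U x & V (iter (H + i) f x)].
Hypothesis periodic : forall U, open U -> X `&` U !=set0 ->
  exists d p, [/\ 0 < p, X d & forall k, U (iter (p * k) f d)].

Lemma open_iter_preimage n (U : set T) : open U -> open (iter n f @^-1` U).
Proof.
move=> oU; apply: open_comp => // x _.
elim: n => [|n IH]; first exact: cvg_id.
by apply: continuous_comp IH _; exact: cf.
Qed.

(** Residues are added one at a time: points of [G] reach [V] at all times of an interval longer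
    than [p], one of which has the next residue, and this is an open condition. *)
Lemma visit_residues (V : set T) p b : 0 < p -> open V -> X `&` V !=set0 ->
  exists2 x, X x & forall j, j < p ->
  exists n, [/\ b <= n, n = j %[mod p] & V (iter n f x)].
Proof.
move=> p0 oV XV.
suff H : forall q, exists G, [/\ open G, X `&` G !=set0 & forall x,
  X x -> G x ->
    forall j, j < q -> exists n, [/\ b <= n, n = j %[mod p] & V (iter n f x)]].
  by have [G [_ [x [Xx Gx]] GP]] := H p; exists x => //; exact: GP.
elim=> [|q [G [oG XG GP]]].
  by exists setT; split => //; [exact: openT|have [x [Xx _]] := XV; exists x].
have [H rH HP] := thick oG oV XG XV (b + p).
pose i := (q + (p - H %% p)) %% p.
have Hi : H + i = q %[mod p].
  rewrite modnDmr addnCA -modnDmr -[(H + _) %% p]modnDml subnKC ?modnn ?addn0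
    //.
  by rewrite ltnW // ltn_mod.
have ip : i < p by rewrite ltn_mod.
have [|x [Xx Gx Vx]] := HP i; first by lia.
exists (G `&` iter (H + i) f @^-1` V); split.
- by apply: openI => //; exact: open_iter_preimage.
- by exists x.
- move=> y Xy [Gy Vy] j; rewrite ltnS leq_eqVlt => /predU1P[->|];
    last exact: GP.
  by exists (H + i); split => //; lia.
Qed.

Lemma disjoint_from_minimal (Y : set S) (g : S -> S) :
  tds Y g -> minimal_system Y g -> disjoint_systems X f Y g.
Proof.
move=> [cY cg gY] Ymin J [[J0 JXY] Jc Jfg JX JY].
apply/seteqP; split => // -[x y] [/= Xx Yy];
  apply: Jc => B [[U W] [/= xU yW] UWB].
have gY' z : Y z -> Y (g z) by move=> Yz; rewrite -gY; exists z.
have Xf z : X z -> exists2 z', Y z' & J (z, z').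
  by rewrite -{1}JX => -[[a b] Jab /= <-]; exists b => //; have [] := JXY _ Jab.
have oU := @open_interior _ U; have oW := @open_interior _ W.
have [|d [p [p0 Xd dU]]] := periodic oU; first by exists x; split.
have Ydense a b : Y a -> Y b -> forall V, nbhs b V -> exists m, V (iter m g a).
  move=> Ya Yb V /(Ymin a Ya b Yb)[_ [[_ [m _ <-]] Vm]]; by exists m.
have [|N NP] := minimal_progressions cY cg gY' (ex_intro _ y Yy) p _ Ydense p0
  oW.
  by exists y.
(* Points visiting the interior of [U] at the times 0, p, ..., N p; [d] is one of them. *)
pose V := \bigcap_(k < N.+1) (iter (p * k) f @^-1` U^°).
have oV : open V.
  rewrite /V bigcap_mkord; elim/big_ind: _ => [|? ?|i _]; first exact: openT.
    exact: openI.
  exact: open_iter_preimage.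
have [|x0 Xx0 x0P] := visit_residues p (2 * p) p0 oV.
  by exists d; split => // k _; exact: dU.
have [y0 Yy0 Jxy] := Xf x0 Xx0.
(* The class [r] depends on the partner [y0] of [x0], so [x0] has to visit [V] in all classes. *)
have [r rp rP] := NP y0 Yy0.
have [n [pn nr Vn]] := x0P r rp.
have [k kN Wk] := rP n pn nr.
have Jm m : J (iter m f x0, iter m g y0) by elim: m => //= m /Jfg.
exists (iter (n + p * k) f x0, iter (n + p * k) g y0); split => //.
apply: UWB; split => /=; apply: interior_subset => //.
by rewrite addnC iterD; exact: (Vn k).
Qed.

End Disjoint.

(** * The hyperspace *)

Section HyperspaceCompact.
Context {R : realType} {T : metricType R}.

Lemma thickening_open (A : set T) (r : R) : open (thickening A r).
Proof.
rewrite openE => x [a Aa /= ax]; rewrite /interior -nbhs_ballE.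
exists (r - mdist a x)%R => /=; first by rewrite subr_gt0.
rewrite ballEmdist => y /= xy; exists a => //=.
by rewrite (le_lt_trans (metric_triangle _ x _)) // -ltrBrDl.
Qed.

(** The limit of an ultrafilter [F] is the set [A] of points all of whose neighbourhoods meet
    [F]-almost every set. *)
Lemma hyperspace_compact (X : set T) : compact X -> compact (hyperspace X).
Proof.
move=> cX; rewrite compact_ultra => F FU FX; have FF := @ultra_proper _ _ FU.
pose A := [set x | X x /\ forall U,
  nbhs x U -> F [set B | hset B `&` U !=set0]].
have near_X := (compact_near_coveringP X).1 cX.
(* A point of [X] outside [A] has a neighbourhood missed by almost every set; compactness of [X]
   makes this uniform. *)
have FA G : open G -> A `<=` G -> F [set B : hyper T | B `<=` G].
  move=> oG AG.
  have H : forall x, X x -> \forall x' \near x & B \near F, hset B x' -> G x'.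
    move=> x Xx; have [Ax|nAx] := pselect (A x).
      exists (G, setT); first by split; [apply: open_nbhs_nbhs; split => //;
        exact: AG|exact: filterT].
      by move=> [x' B] [].
    have [U xU nFU] : exists2 U, nbhs x U & ~ F [set B | hset B `&` U !=set0].
      by apply: contrapT => nU; apply: nAx; split => // U xU;
        apply: contrapT => nFU; apply: nU; exists U.
    exists (U, ~` [set B | hset B `&` U !=set0]) => /=.
      by split => //; have [//|] := in_ultra_setVsetC [set B | hset B `&` U
        !=set0] FU.
    by move=> [x' B] /= [Ux' nB] Bx'; case: nB; exists x'.
  have near_B := near_X _ F (fun B x => hset B x -> G x) FF H.
  apply: filterS2 near_B FX => B BG BX x Bx.
  by apply: BG => //; exact: BX.
have A0 : A !=set0.
  apply: contrapT => nA.
  have /FA : A `<=` set0 by move=> x Ax; apply: nA; exists x.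
  move=> /(_ open0) /filter_ex[B B0].
  by have [x /B0] := hset_neq0 B.
have AX : A `<=` X by move=> x [].
have cA : compact A.
  apply: (subclosed_compact _ cX AX) => x Ax; split.
    apply: (compact_closed _ cX); first exact: metric_hausdorff.
    by apply: closureS Ax.
  move=> U xU; have [y [[_ yF] yU]] := Ax _ (nbhs_interior xU).
  exact: yF.
exists (Hyper A0 cA); split => //.
apply/cvg_ballP => r r0; rewrite ballEmdist.
have r20 : (0 < r / 2)%R by rewrite divr_gt0.
have r40 : (0 < r / 2 / 2)%R by rewrite divr_gt0.
have near_A := (compact_near_coveringP A).1 cA.
have H : forall x, A x -> \forall x' \near x & B \near F,
  thickening (hset B) (r / 2) x'.
  move=> x [Xx xF].
  exists (ball x (r / 2 / 2),
    [set B | hset B `&` ball x (r / 2 / 2) !=set0])%R => /=.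
    by split; [exact: nbhsx_ballx|apply: xF; exact: nbhsx_ballx].
  move=> [x' B] /=; rewrite ballEmdist /= => -[xx' [b [Bb /= xb]]];
    exists b => //=.
  rewrite (le_lt_trans (metric_triangle _ x _)) // (splitr (r / 2)%R) ltrD //.
  by rewrite metric_sym.
have near1 := near_A _ F (fun B x => thickening (hset B) (r / 2)%R x) FF H.
have near2 : F [set B : hyper T | B `<=` thickening A (r / 2)].
  apply: FA; first exact: thickening_open.
  by move=> x Ax; exists x => //=; rewrite mdistxx.
apply: filterS2 near1 near2 => B AB BA /=.
(* The infimum gives only a weak inequality, hence the radius [r / 2]. *)
apply: (@le_lt_trans _ _ (r / 2)%R);
  last by rewrite ltr_pdivrMr // ltr_pMr // ltr1n.
exact: hausdorff_dist_le.
Qed.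

End HyperspaceCompact.

Section HyperSigma.
Context {R : realType}.
Local Notation hyperSigma := (@hyper R Sigma2).
Local Notation hsigma := (hyper_map sigma_continuous : hyperSigma ->
  hyperSigma).

Definition same_prefixes (l : nat) (A B : set Sigma2) : Prop :=
  (forall x, A x -> exists2 y, B y & agree l x y) /\
  (forall y, B y -> exists2 x, A x & agree l x y).

Lemma same_prefixes_le l m A B : l <= m ->
  same_prefixes m A B -> same_prefixes l A B.
Proof.
move=> lm [AB BA]; split=> [x /AB[y By xy]|y /BA[x Ax xy]].
  by exists y => // i il; apply: xy; exact: leq_trans lm.
by exists x => // i il; apply: xy; exact: leq_trans lm.
Qed.

Lemma nbhs_hyperP (A : hyperSigma) (U : set hyperSigma) : nbhs A U ->
  exists l, forall B : hyperSigma, same_prefixes l A B -> U B.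
Proof.
rewrite -nbhs_ballE => -[r /= r0 rU].
have [m _ mr] := near_infty_natSinv_expn_lt (PosNum r0).
exists m.+1 => B [AB BA]; apply: rU; rewrite ballEmdist /=.
apply: le_lt_trans (mr m (leqnn m)); rewrite div1r.
apply: hausdorff_dist_le; split; first by rewrite invr_gt0 exprn_gt0.
- move=> x /AB[y By xy]; exists y => //=.
  by apply/Sigma2_dist_ltP => i im; rewrite xy.
- move=> y /BA[x Ax xy]; exists x => //=.
  by apply/Sigma2_dist_ltP => i im; rewrite xy.
Qed.

Lemma nbhs_same_prefixes l (A : hyperSigma) :
  nbhs A [set B : hyperSigma | same_prefixes l A B].
Proof.
rewrite -nbhs_ballE; exists (2 ^- l)%R => /=;
  first by rewrite invr_gt0 exprn_gt0.
rewrite ballEmdist => B /= /hausdorff_dist_lt[_ AB BA]; split=> [x /AB|y /BA].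
- move=> [y By /= /Sigma2_dist_ltP yx]; exists y => // i il.
  by rewrite yx // ltnW.
- move=> [x Ax /= /Sigma2_dist_ltP xy]; exists x => // i il.
  by rewrite xy // ltnW.
Qed.

Lemma hsigma_continuous : continuous hsigma.
Proof.
move=> A U /nbhs_hyperP[l lU]; apply: filterS (nbhs_same_prefixes l.+1 A).
move=> B [AB BA]; apply: lU; split.
- move=> _ [x /AB[y By xy] <-]; exists (sigma y); first by exists y.
  by move=> i il; apply: xy.
- move=> _ [y /BA[x Ax xy] <-]; exists (sigma x); first by exists x.
  by move=> i il; apply: xy.
Qed.

Lemma iter_hsigma n (A : hyperSigma) :
  hset (iter n hsigma A) = iter n sigma @` A.
Proof.
elim: n => [|n IH]; first by rewrite image_id.
by rewrite iterS /= IH image_comp.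
Qed.

Lemma hsigma_image (X : set Sigma2) : compact X -> sigma @` X = X ->
  hsigma @` hyperspace X = hyperspace X.
Proof.
move=> cX sX; apply/seteqP; split.
  by move=> _ [A AX <-] /= _ [x /AX Xx <-]; rewrite -sX; exists x.
move=> A AX; pose B := X `&` sigma @^-1` A.
have cB : compact B.
  apply: (subclosed_compact _ cX); last by move=> x [].
  apply: closedI; first by exact: (compact_closed cantor_space_hausdorff cX).
  by apply: closed_comp => [x _|];
    [exact: sigma_continuous|exact: hyper_closed].
have lift a : hset A a -> exists2 x, B x & sigma x = a.
  by move=> Aa; move: (AX _ Aa); rewrite -sX => -[x Xx xa]; exists x => //;
    split => //=; rewrite xa.
have B0 : B !=set0 by have [a /lift[x Bx _]] := hset_neq0 A; exists x.
exists (Hyper B0 cB); first by move=> x [].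
apply: hyper_inj; apply/seteqP; split; first by move=> _ [x [_ Ax] <-].
by move=> a /lift[x Bx xa]; exists x.
Qed.

End HyperSigma.

(** * Return times in [XX] and in its hyperspace *)

Section Main.
Variables (w : nat -> word) (t : nat -> nat) (e : nat -> seq word).
Variable (R : realType).
Hypothesis c : construction w t e R.
Let X := XX w t.
Local Notation hyperSigma := (@hyper R Sigma2).
Local Notation hsigma := (hyper_map sigma_continuous : hyperSigma ->
  hyperSigma).
Let KX : set hyperSigma := hyperspace X.

Lemma occurs_mkseq0 (x y : Sigma2) p l :
  occurs x p (mkseq y l) <-> forall i, i < l -> x (p + i) = y i.
Proof. exact: (occurs_mkseq x p y 0 l). Qed.

Lemma XX_thick_prefix l r : exists2 H, r <= H & forall i, i <= r ->
  forall a b, X a -> X b -> exists x, [/\ X x, agree l a x &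
    agree l b (iter (H + i) sigma x)].
Proof.
have [H rH HP] := XX_thick c l r; exists H => // i ir a b Xa Xb.
have [||//|//|x [Xx xa xb]] := HP i ir (mkseq a l) (mkseq b l).
- exact: XX_admissible.
- exact: XX_admissible.
- by rewrite size_mkseq.
- by rewrite size_mkseq.
exists x; split => // j jl.
  by move/occurs_mkseq0: xa => /(_ j jl).
by rewrite iter_sigmaE; move/occurs_mkseq0: xb => /(_ j jl) ->.
Qed.

Lemma XX_periodic_prefix l : exists2 p, 0 < p & forall a, X a ->
  exists D : set Sigma2, [/\ D !=set0, D `<=` X, iter p sigma @` D = D &
    forall x, D x -> agree l a x].
Proof.
have [p p0 pP] := XX_periodic c l; exists p => // a Xa.
have [||D [D0 _ DX Dp Da]] := pP (mkseq a l).
- exact: XX_admissible.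
- by rewrite size_mkseq.
exists D; split => // x /Da /occurs_mkseq0 xa i il.
by rewrite -xa.
Qed.

Lemma XX_thick_open U V : open U -> open V -> X `&` U !=set0 -> X `&` V !=set0
  ->
  forall r, exists2 H, r <= H & forall i, i <= r ->
  exists x, [/\ X x, U x & V (iter (H + i) sigma x)].
Proof.
move=> oU oV [a [Xa Ua]] [b [Xb Vb]] r.
have [l1 lU] := nbhs_Sigma2P (open_nbhs_nbhs (conj oU Ua)).
have [l2 lV] := nbhs_Sigma2P (open_nbhs_nbhs (conj oV Vb)).
have [H rH HP] := XX_thick_prefix (l1 + l2) r; exists H => // i ir.
have [x [Xx ax bx]] := HP i ir a b Xa Xb; exists x; split => //.
  by apply: lU => j jl; apply: ax; lia.
by apply: lV => j jl; apply: bx; lia.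
Qed.

Lemma XX_periodic_open U : open U -> X `&` U !=set0 ->
  exists d p, [/\ 0 < p, X d & forall k, U (iter (p * k) sigma d)].
Proof.
move=> oU [a [Xa Ua]]; have [l lU] := nbhs_Sigma2P (open_nbhs_nbhs (conj oU
  Ua)).
have [p p0 pP] := XX_periodic_prefix l; have [D [[d Dd] DX Dp Da]] := pP a Xa.
exists d, p; split => // [|k]; first exact: DX.
apply: lU; apply: Da; elim: k => [|k IH]; first by rewrite muln0.
by rewrite mulnS iterD -Dp; exists (iter (p * k) sigma d).
Qed.

(** The times do not depend on the pair of points, so all points of [A] and [B] are matched at the
    same time [n]; [C] collects the points that follow such pairs. *)
Lemma hyper_thick_open U V : open U -> open V -> KX `&` U !=set0 ->
  KX `&` V !=set0 -> forall r, exists2 H, r <= H & forall i, i <= r ->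
  exists A, [/\ KX A, U A & V (iter (H + i) hsigma A)].
Proof.
move=> oU oV [A [KA UA]] [B [KB VB]] r.
have [l1 lU] := nbhs_hyperP (open_nbhs_nbhs (conj oU UA)).
have [l2 lV] := nbhs_hyperP (open_nbhs_nbhs (conj oV VB)).
set l := l1 + l2.
have [H rH HP] := XX_thick_prefix l r; exists H => // i ir; set n := H + i.
pose C := [set x | [/\ X x, exists2 a, hset A a & agree l a x &
  exists2 b, hset B b & agree l b (iter n sigma x)]].
have Cab a b : hset A a -> hset B b -> exists x, [/\ C x,
  agree l a x & agree l b (iter n sigma x)].
  move=> Aa Bb; have [x [Xx ax bx]] := HP i ir a b (KA _ Aa) (KB _ Bb).
  by exists x; split => //; split => //; [exists a|exists b].
have [a0 Aa0] := hset_neq0 A; have [b0 Bb0] := hset_neq0 B.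
have C0 : C !=set0 by have [x [Cx _ _]] := Cab _ _ Aa0 Bb0; exists x.
have cC : compact C.
  apply: subclosed_compact cantor_space_compact _ => // x Cx; split.
  - by apply: closed_closure; apply: closureS Cx => y [].
  - move/closure_Sigma2P: Cx => /(_ l)[y [_ [a Aa ay] _] xy].
    by exists a => // j jl; rewrite ay // xy.
  - move/closure_Sigma2P: Cx => /(_ (n + l))[y [_ _ [b Bb bY]] xy].
    by exists b => // j jl; rewrite bY // !iter_sigmaE xy // ltn_add2l.
exists (Hyper C0 cC); split.
- by move=> x [].
- apply: lU; apply: (@same_prefixes_le l1 l); first exact: leq_addr.
  split; last by move=> x [].
  by move=> a Aa; have [x [Cx ax _]] := Cab _ _ Aa Bb0; exists x.
- apply: lV; apply: (@same_prefixes_le l2 l); first exact: leq_addl.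
  rewrite iter_hsigma; split.
    by move=> b Bb; have [x [Cx _ bx]] := Cab _ _ Aa0 Bb;
      exists (iter n sigma x) => //; exists x.
  by move=> _ [x [_ _ xB] <-].
Qed.

(** One [p] serves all points of [A], so the closure of the union of the invariant sets agreeing
    with them on [l] letters is fixed by the [p]-th power; its points need not be periodic. *)
Lemma hyper_periodic_open A U : KX A -> nbhs A U -> exists B p,
  [/\ 0 < p, KX B, U B & iter p hsigma B = B].
Proof.
move=> KA /nbhs_hyperP[l lU]; have [p p0 pP] := XX_periodic_prefix l.
pose good := [set D : set Sigma2 | [/\ D `<=` X, iter p sigma @` D = D &
  exists2 a, hset A a & forall x, D x -> agree l a x]].
pose G := \bigcup_(D in good) D; pose B := closure G.
have GA a : hset A a -> exists2 x, G x & agree l a x.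
  move=> Aa; have [D [[d Dd] DX Dp Da]] := pP a (KA _ Aa).
  by exists d; [exists D => //; split => //; exists a|exact: Da].
have [a0 /GA[x0 Gx0 _]] := hset_neq0 A.
have B0 : B !=set0 by exists x0; exact: subset_closure.
have cB : compact B.
  by apply: subclosed_compact cantor_space_compact _ => //;
    exact: closed_closure.
have Gp : iter p sigma @` G = G.
  apply/seteqP; split.
    move=> _ [x [D gD Dx] <-]; exists D => //; have [_ Dp _] := gD.
    by rewrite -Dp; exists x.
  move=> x [D gD Dx]; have [_ Dp _] := gD.
  by move: Dx; rewrite -{1}Dp => -[y Dy <-]; exists y => //; exists D.
exists (Hyper B0 cB), p; split => //.
- move=> x Bx; apply: closed_closure; apply: closureS Bx => y [D [DX _ _] Dy].
  exact: DX.
- apply: lU; split; first by move=> a /GA[x Gx ax]; exists x => //;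
    exact: subset_closure.
  move=> x /closure_Sigma2P/(_ l)[y [D [_ _ [a Aa aD]] Dy] xy].
  by exists a => // i il; rewrite (aD _ Dy) ?xy.
- apply: hyper_inj; rewrite iter_hsigma /= /B image_closure ?Gp //.
  exact: iter_sigma_continuous.
Qed.

Lemma hyper_P_system : P_system KX hsigma.
Proof.
have cX : compact X by exact: XX_compact.
split.
- split; first exact: hyperspace_compact.
    by apply: continuous_subspaceT; exact: hsigma_continuous.
  by apply: hsigma_image => //; exact: sigma_XX.
- move=> U V oU oV KU KV /finite_seqP[s sE].
  (* If the return times formed a finite list, [H] would be one beyond its maximum. *)
  have [H rH HP] := hyper_thick_open oU oV KU KV (\max_(i <- s) i).+1.
  have [A [KA UA]] := HP 0 isT; rewrite addn0 => VA.
  have : [set n | exists x, [/\ KX x, U x & V (iter n hsigma x)]] H by exists A.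
  rewrite sE /= => Hs; have := @leq_bigmax_seq _ s xpredT id H Hs isT;
    rewrite /= => H1.
  by move: (leq_trans rH H1); rewrite ltnn.
- move=> A KA U AU; have [B [p [p0 KB UB Bp]]] := hyper_periodic_open KA AU.
  by exists B; split => //; split => //; exists p.
Qed.

End Main.

Local Open Scope ring_scope.

Theorem corollary6p5 (R : realType) (w : nat -> word) (t : nat -> nat)
    (e : nat -> seq word) (w_t_e : construction w t e R) :
  [/\ subshift (XX w t) /\ tds (R := R) (XX w t) sigma,
      ~ dense_distal_points (R := R) (XX w t) sigma,
      P_system (hyperspace (R := R) (XX w t)) (hyper_map sigma_continuous) &
      forall (S : metricType R) (Y : set S) (g : S -> S),
        tds Y g -> minimal_system Y g ->
        disjoint_systems (XX w t) sigma Y g /\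
        disjoint_systems (hyperspace (XX w t)) (hyper_map sigma_continuous) Y g].
Proof.
have sX := sigma_XX w t; have cX := XX_compact w t.
split.
- split; split.
  + by exists (iter 0 sigma (Defs.limit_point (w 1) (t 1)));
      apply: (@MM_XX _ _ 1) => //; exact: limit_point_MM.
  + exact: closed_closure.
  + by rewrite sX.
  + exact: cX.
  + by apply: continuous_subspaceT; exact: sigma_continuous.
  + exact: sX.
- exact: (not_dense_distal w_t_e).
- exact: (hyper_P_system w_t_e).
- move=> S Y g tY mY; split; apply: disjoint_from_minimal => //.
  + exact: sigma_continuous.
  + exact: (XX_thick_open w_t_e).
  + exact: (XX_periodic_open w_t_e).
  + exact: hsigma_continuous.
  + exact: (hyper_thick_open w_t_e).
  + move=> U oU [A [KA UA]].
    have [B [p [p0 KB UB Bp]]] := hyper_periodic_open w_t_e KA (open_nbhs_nbhs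
      (conj oU UA)).
    exists B, p; split => // k; elim: k => [|k IH]; first by rewrite muln0.
    by rewrite mulnS addnC iterD Bp.
Qed.
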